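(* Let $\Gamma=(X,R)$ be a bipartite distance-regular graph with diameter $D\ge4$ and valency $k\ge3$, fix $x\in X$, let $W$ be a thin irreducible $T(x)$-module with endpoint $2$ and local eigenvalue $\eta$ with $\tilde\theta_1<\eta<\tilde\theta_d$, and let $v$ be a nonzero vector in $E^*_2W$. (i) If $\eta\ne-1$, then for $0\le i\le D-2$, $\displaystyle E^*_{i+2}A_iv=\sum_{j=1}^{D-1}g_i(\theta_j)E_jv$, where $\displaystyle g_i=\sum_{\substack{h=0\\ i-h\ \text{even}}}^{i}\frac{P_h(\psi)}{P_i(\psi)}\,\frac{k_ib_ib_{i+1}}{k_hb_hb_{h+1}}\,p_h$ and $\psi=b_2\bigl(1-\frac{b_3}{1+\eta}\bigr)$. (ii) If $\eta=-1$, then $\displaystyle E^*_{i+2}A_iv=\sum_{j=1}^{D-1}p_i(\theta_j)E_jv$ for $0\le i\le D-2$.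
   Context: $\Gamma$ is a finite connected bipartite distance-regular graph with distance $\partial$, intersection numbers $c_i,b_i$ ($c_0=0,b_D=0$), $k_i=b_0\cdots b_{i-1}/(c_1\cdots c_i)$. $A_i$ distance matrices, $A=A_1$, eigenvalues $\theta_0>\dots>\theta_D$, $E_i$ primitive idempotent for $\theta_i$; $d=\lfloor D/2\rfloor$. $E^*_i$ diagonal with $(y,y)$-entry $1$ if $\partial(x,y)=i$, else $0$; $T(x)$ generated by $A,E^*_0,\dots,E^*_D$; thin: $\dim E^*_iW\le1$ for all $i$; endpoint $\min\{i:E^*_iW\ne0\}$; local eigenvalue of thin irreducible $W$ with endpoint 2: eigenvalue of $E^*_2A_2E^*_2$ on $E^*_2W$. $\tilde\theta_1=-1-b_2b_3(\theta_1^2-b_2)^{-1}$, $\tilde\theta_d=-1-b_2b_3(\theta_d^2-b_2)^{-1}$. Polynomials: $f_0=1,f_{-1}=0$, $\lambda f_i=b_{i-1}f_{i-1}+c_{i+1}f_{i+1}$; $p_i=f_i+f_{i-2}+\cdots$ (ending in $f_0$ or $f_1$ according to parity); $p_i(\lambda)=P_i(\lambda^2)$ for $i$ even, $p_i(\lambda)=\lambda P_i(\lambda^2)$ for $i$ odd. *)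

(* Defs.v *)
From mathcomp Require Import all_boot all_order all_algebra.

Set Implicit Arguments.
Unset Strict Implicit.
Unset Printing Implicit Defensive.

Import Order.TTheory GRing.Theory Num.Theory.
Local Open Scope ring_scope.

(* A graph with vertex set X is given by its adjacency relation e : rel X.   *)

Definition simple_graph (X : finType) (e : rel X) : Prop :=
  symmetric e /\ irreflexive e.

Definition connected_graph (X : finType) (e : rel X) : Prop :=
  forall y z : X, connect e y z.

Definition bipartite (X : finType) (e : rel X) : Prop :=
  exists S : {set X}, forall y z : X, e y z -> (y \in S) != (z \in S).

(* Least n < #|X| such that there is a walk of length n from y to z, and     *)
(* #|X| if there is none (which cannot happen in a connected graph).         *)
Definition gdist (X : finType) (e : rel X) (y z : X) : nat :=
  find (fun n => [exists s : n.-tuple X, path e y s && (last y s == z)])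
       (iota 0 #|X|).

Definition diameter (X : finType) (e : rel X) : nat :=
  (\max_(y : X) \max_(z : X) gdist e y z)%N.

Definition regular_of_valency (X : finType) (e : rel X) (k : nat) : Prop :=
  forall y : X, #|[set z | e y z]| = k.

Definition pcount (X : finType) (e : rel X) (i j : nat) (y z : X) : nat :=
  #|[set w | (gdist e y w == i) && (gdist e z w == j)]|.

Definition distance_regular (X : finType) (e : rel X) : Prop :=
  forall (i j : nat) (y z y' z' : X),
    gdist e y z = gdist e y' z' -> pcount e i j y z = pcount e i j y' z'.

(* The intersection number p^h_{ij}: the value of pcount at some pair of     *)
(* vertices at distance h; in a distance-regular graph the choice of the     *)
(* pair does not matter.  It is 0 if h exceeds the diameter.                 *)
Definition inum (X : finType) (e : rel X) (h i j : nat) : nat :=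
  if [pick u : X * X | gdist e u.1 u.2 == h] is Some u
  then pcount e i j u.1 u.2 else 0%N.

(* c_i = p^i_{1,i-1} and b_i = p^i_{1,i+1}; in particular c_0 = b_D = 0.     *)
Definition cnum (X : finType) (e : rel X) (i : nat) : nat := inum e i 1 i.-1.
Definition bnum (X : finType) (e : rel X) (i : nat) : nat := inum e i 1 i.+1.

Definition knum (C : fieldType) (X : finType) (e : rel X) (i : nat) : C :=
  (\prod_(0 <= h < i) (bnum e h)%:R) / \prod_(1 <= h < i.+1) (cnum e h)%:R.

(* Matrices and vectors indexed by X use the bijection enum_val from         *)
(* 'I_#|X| onto X.                                                           *)

Definition Amx (C : fieldType) (X : finType) (e : rel X) (i : nat) :
    'M[C]_#|X| :=
  \matrix_(r, s) (gdist e (enum_val r) (enum_val s) == i)%:R.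

Definition Estar (C : fieldType) (X : finType) (e : rel X) (x : X) (i : nat) :
    'M[C]_#|X| :=
  diag_mx (\row_r (gdist e x (enum_val r) == i)%:R).

(* theta 0 > ... > theta D are the eigenvalues of A.  The order on C only    *)
(* relates numbers whose difference is real; A being symmetric and real, its *)
(* eigenvalues are real.                                                     *)
Definition ordered_eigenvalues (C : numClosedFieldType) (X : finType)
    (e : rel X) (D : nat) (theta : nat -> C) : Prop :=
  (forall i j : nat, (i < j <= D)%N -> theta j < theta i) /\
  (forall a : C, eigenvalue (Amx C e 1) a <->
                 exists2 i : nat, (i <= D)%N & a = theta i).

Definition in_Bose_Mesner (C : fieldType) (X : finType) (e : rel X)
    (D : nat) (B : 'M[C]_#|X|) : Prop :=
  exists a : nat -> C, B = \sum_(0 <= h < D.+1) a h *: Amx C e h.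

(* E_0, ..., E_D are the primitive idempotents of the Bose-Mesner algebra,   *)
(* numbered so that E_i belongs to theta_i.  As that algebra has dimension   *)
(* D+1, such a family of D+1 nonzero idempotents is a basis of it.           *)
Definition primitive_idempotents (C : fieldType) (X : finType) (e : rel X)
    (D : nat) (theta : nat -> C) (E : nat -> 'M[C]_#|X|) : Prop :=
  [/\ forall i : nat, (i <= D)%N -> in_Bose_Mesner e D (E i) /\ E i != 0,
      forall i j : nat, (i <= D)%N -> (j <= D)%N ->
        E i *m E j = if i == j then E i else 0,
      \sum_(0 <= i < D.+1) E i = 1%:M &
      forall i : nat, (i <= D)%N -> Amx C e 1 *m E i = theta i *: E i].

(* T(x), the algebra generated by A, E*_0, ..., E*_D. *)
Inductive in_T (C : fieldType) (X : finType) (e : rel X) (x : X) (D : nat) :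
    'M[C]_#|X| -> Prop :=
| in_T_A : in_T e x D (Amx C e 1)
| in_T_Estar (i : nat) : (i <= D)%N -> in_T e x D (Estar C e x i)
| in_T_1 : in_T e x D 1%:M
| in_T_scale (a : C) (B : 'M[C]_#|X|) : in_T e x D B -> in_T e x D (a *: B)
| in_T_add (B B' : 'M[C]_#|X|) :
    in_T e x D B -> in_T e x D B' -> in_T e x D (B + B')
| in_T_mul (B B' : 'M[C]_#|X|) :
    in_T e x D B -> in_T e x D B' -> in_T e x D (B *m B').

Definition Tmodule (C : fieldType) (X : finType) (e : rel X) (x : X) (D : nat)
    (W : {vspace 'cV[C]_#|X|}) : Prop :=
  forall B : 'M[C]_#|X|, in_T e x D B ->
  forall w : 'cV[C]_#|X|, w \in W -> B *m w \in W.

Definition irreducible_Tmodule (C : fieldType) (X : finType) (e : rel X)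
    (x : X) (D : nat) (W : {vspace 'cV[C]_#|X|}) : Prop :=
  [/\ Tmodule e x D W, W != 0%VS &
      forall U : {vspace 'cV[C]_#|X|},
        Tmodule e x D U -> (U <= W)%VS -> U = 0%VS \/ U = W].

(* The subspace E*_i W. *)
Definition EstarV (C : fieldType) (X : finType) (e : rel X) (x : X) (i : nat)
    (W : {vspace 'cV[C]_#|X|}) : {vspace 'cV[C]_#|X|} :=
  (linfun (mulmx (Estar C e x i)) @: W)%VS.

Definition thin (C : fieldType) (X : finType) (e : rel X) (x : X) (D : nat)
    (W : {vspace 'cV[C]_#|X|}) : Prop :=
  forall i : nat, (i <= D)%N -> (\dim (EstarV e x i W) <= 1)%N.

Definition has_endpoint (C : fieldType) (X : finType) (e : rel X) (x : X)
    (W : {vspace 'cV[C]_#|X|}) (r : nat) : Prop :=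
  EstarV e x r W != 0%VS /\
  forall i : nat, (i < r)%N -> EstarV e x i W = 0%VS.

(* eta is an eigenvalue of E*_2 A_2 E*_2 on E*_2 W. *)
Definition local_eigenvalue (C : fieldType) (X : finType) (e : rel X) (x : X)
    (W : {vspace 'cV[C]_#|X|}) (eta : C) : Prop :=
  exists u : 'cV[C]_#|X|, [/\ u \in EstarV e x 2 W, u != 0 &
    Estar C e x 2 *m Amx C e 2 *m Estar C e x 2 *m u = eta *: u].

Definition tilde (C : fieldType) (X : finType) (e : rel X) (t : C) : C :=
  - 1 - (bnum e 2)%:R * (bnum e 3)%:R * (t ^+ 2 - (bnum e 2)%:R)^-1.

(* f_0 = 1 and 'X * f_i = b_{i-1} f_{i-1} + c_{i+1} f_{i+1} with f_{-1} = 0; *)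
(* only f_0, ..., f_D are meaningful, since c_i = 0 for i > D.               *)
Fixpoint fpoly (C : fieldType) (X : finType) (e : rel X) (i : nat) :
    {poly C} :=
  match i with
  | 0 => 1
  | 1 => (cnum e 1)%:R^-1 *: 'X
  | (m.+1 as n).+1 =>
      (cnum e n.+1)%:R^-1 *: ('X * fpoly C e n - (bnum e m)%:R *: fpoly C e m)
  end.

Definition ppoly (C : fieldType) (X : finType) (e : rel X) (i : nat) :
    {poly C} :=
  \sum_(h < i.+1 | ~~ odd (i - h)) fpoly C e h.

(* P_i is obtained by keeping every other coefficient of p_i; its defining   *)
(* property is Ppoly_spec below.                                             *)
Definition Ppoly (C : fieldType) (X : finType) (e : rel X) (i : nat) :
    {poly C} :=
  if odd i then odd_poly (ppoly C e i) else even_poly (ppoly C e i).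

Definition gpoly (C : fieldType) (X : finType) (e : rel X) (psi : C)
    (i : nat) : {poly C} :=
  \sum_(h < i.+1 | ~~ odd (i - h))
    ((Ppoly C e h).[psi] / (Ppoly C e i).[psi] *
     ((knum C e i * (bnum e i)%:R * (bnum e i.+1)%:R) /
      (knum C e h * (bnum e h)%:R * (bnum e h.+1)%:R))) *: ppoly C e h.

Lemma fpoly_coef_parity (C : fieldType) (X : finType) (e : rel X) (i j : nat) :
  odd (i + j) -> (fpoly C e i)`_j = 0.
Proof.
suff H n : (forall j, odd (n + j) -> (fpoly C e n)`_j = 0) /\
           (forall j, odd (n.+1 + j) -> (fpoly C e n.+1)`_j = 0).
  exact: (proj1 (H i)).
elim: n => [|n [IH1 IH2]].
  split=> k; first by rewrite add0n coef1; case: k.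
  by rewrite /= coefZ coefX; case: k => [|[|k]] //=; rewrite mulr0.
split=> // k hk; rewrite [fpoly _ _ _]/= coefZ coefB coefZ coefXM.
rewrite IH1; last by move: hk; rewrite !addSn /= negbK.
case: k hk => [|k] hk /=; first by rewrite mulr0 subr0 mulr0.
rewrite -/(fpoly C e n.+1) IH2; first by rewrite mulr0 subr0 mulr0.
by move: hk; rewrite !addSn !addnS /= !negbK.
Qed.

Lemma ppoly_coef_parity (C : fieldType) (X : finType) (e : rel X) (i j : nat) :
  odd (i + j) -> (ppoly C e i)`_j = 0.
Proof.
move=> hij; rewrite /ppoly coef_sum big1 // => h hh.
apply: fpoly_coef_parity; move: hh hij.
by rewrite oddB ?(leq_ord h) // !oddD; case: (odd i); case: (odd h).
Qed.

Lemma Ppoly_spec (C : fieldType) (X : finType) (e : rel X) (i : nat) (t : C) :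
  (ppoly C e i).[t] =
    if odd i then t * (Ppoly C e i).[t ^+ 2] else (Ppoly C e i).[t ^+ 2].
Proof.
rewrite -{1}(poly_even_odd (ppoly C e i)) /Ppoly.
case hi: (odd i).
  have -> : even_poly (ppoly C e i) = 0.
    apply/polyP=> j; rewrite coef_even_poly coef0 ppoly_coef_parity //.
    by rewrite oddD hi odd_double.
  by rewrite comp_poly0 add0r hornerMX horner_comp hornerXn mulrC.
have -> : odd_poly (ppoly C e i) = 0.
  apply/polyP=> j; rewrite coef_odd_poly coef0 ppoly_coef_parity //.
  by rewrite oddD hi /= odd_double.
by rewrite comp_poly0 mul0r addr0 horner_comp hornerXn.
Qed.

(* Main.v *)
Require Import Defs.
From mathcomp Require Import all_boot all_order all_algebra.
From mathcomp Require Import ring zify.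

(* Put u_{i+2} = E*_{i+2} A_i v. Thinness makes A act tridiagonally,
     A u_{i+2} = c_{i+1} u_{i+3} + xi_i u_{i+1}.
   The entries of v sum to 0 and v lives in layer 2, so E*_i p_j(A) v = 0 for
   i < j, which leaves p_j(A) v = u_{j+2} + alpha_j u_j. Applying A and the
   recurrence x p_j = c_{j+1} p_{j+1} + b_{j+1} p_{j-1} yields recurrences tying
   alpha to xi. They start from alpha_2 = 1 + eta, and are solved by alpha = 0
   if eta = -1 and by
     alpha_j = - b_j b_{j+1} P_{j-2}(psi) / (c_{j-1} c_j P_j(psi))
   otherwise; solving p_j(A) v = u_{j+2} + alpha_j u_j for the u's gives g_j.
   Everything rests on u_2, ..., u_D being nonzero, i.e. on E_j v <> 0 for
   0 < j < D: writing E_j = sum_h a_h A_h, the vector E*_2 E_j v is v times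
   a positive multiple of a_0 (b_2 b_3 + (1 + eta) (theta_j^2 - b_2)), and the
   bounds on eta say that this affine function of theta_j^2 is positive at
   theta_1^2 and at theta_d^2. *)

Set Implicit Arguments.
Unset Strict Implicit.
Unset Printing Implicit Defensive.

Import Order.TTheory GRing.Theory Num.Theory.
Local Open Scope ring_scope.

(** * Distance *)

Section Distance.
Variables (X : finType) (e : rel X).
Hypothesis (e_sym : symmetric e) (eirr : irreflexive e).
Hypothesis econn : connected_graph e.
Local Notation d := (gdist e).
Local Open Scope nat_scope.

Lemma gdist_le_walk y s : path e y s -> d y (last y s) <= size s.
Proof.
move=> ps; rewrite /gdist; set a := fun n : nat => _.
have aS : a (size s).
  by apply/existsP; exists (in_tuple s); rewrite ps /=.
case: (ltnP (size s) #|X|) => hs.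
  rewrite leqNgt; apply/negP => /(before_find 0).
  by rewrite nth_iota // add0n aS.
(* A walk too long for the search range: [find] never returns more than [#|X|]. *)
by apply: leq_trans hs; rewrite -{2}(size_iota 0 #|X|) find_size.
Qed.

(** Connectivity gives a walk, and shortening it to one without repeated vertices makes its length
    less than [#|X|], so the search defining [gdist] succeeds. *)
Lemma gdist_walk y z : exists s, [/\ path e y s, last y s = z & size s = d y z].
Proof.
rewrite /gdist; set a := fun n : nat => _.
have ha : has a (iota 0 #|X|).
  have /connectP[p pp] := econn y z; case/shortenP: pp => q pq uq _ zl.
  apply/hasP; exists (size q); last first.
    by apply/existsP; exists (in_tuple q); rewrite pq /= zl.
  by rewrite mem_iota /= add0n -[(size q).+1]/(size (y :: q)) -(card_uniqP uq) max_card.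
have := nth_find 0 ha; set n := find _ _ => an.
have hn : n < #|X| by move: ha; rewrite has_find size_iota.
move: an; rewrite nth_iota // add0n => /existsP[t /andP[pt /eqP lt]].
by exists t; rewrite size_tuple.
Qed.

Lemma gdistxx y : d y y = 0.
Proof. by apply/eqP; rewrite -leqn0; apply: (@gdist_le_walk y [::]). Qed.

Lemma gdist_eq0 y z : (d y z == 0) = (y == z).
Proof.
apply/eqP/eqP => [h|->]; last exact: gdistxx.
by have [[|u s] [_ ls]] := gdist_walk y z; rewrite h.
Qed.

Lemma gdist_triangle y z u : d y u <= d y z + d z u.
Proof.
have [s [ps ls <-]] := gdist_walk y z; have [t [pt lt <-]] := gdist_walk z u.
rewrite -size_cat -lt -ls -last_cat; apply: gdist_le_walk.
by rewrite cat_path ps ls pt.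
Qed.

Lemma gdist_sym y z : d y z = d z y.
Proof.
suff h u w : d u w <= d w u by apply/eqP; rewrite eqn_leq !h.
have [s [ps <- <-]] := gdist_walk w u.
have lw : last (last w s) (rev (belast w s)) = w.
  by case: s {ps} => //= a s; rewrite rev_cons last_rcons.
rewrite -[leqRHS](size_belast w) -size_rev -[X in d _ X]lw; apply: gdist_le_walk.
by rewrite rev_path (eq_path (e' := e)) // => a b; rewrite e_sym.
Qed.

Lemma gdist_eq1 y z : (d y z == 1) = e y z.
Proof.
apply/eqP/idP => [h|eyz].
  by have [[|u [|w s]] [/= ps ls]] := gdist_walk y z; rewrite h // -ls; case/andP: ps.
apply/eqP; rewrite eqn_leq; apply/andP; split.
  by apply: (@gdist_le_walk y [:: z]); rewrite /= eyz.
rewrite lt0n gdist_eq0.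
by apply/negP => /eqP yz; move: eyz; rewrite yz eirr.
Qed.

Lemma gdist_step y z n : d y z = n.+1 -> exists2 u, e y u & d u z = n.
Proof.
have [[|u s] [/= ps ls sz]] := gdist_walk y z; rewrite -sz // => -[sn].
have /andP[eyu ps'] := ps; exists u => //.
apply/eqP; rewrite eqn_leq -{1}ls -{1}sn gdist_le_walk //=.
have := gdist_triangle y u z; have /eqP -> : d y u == 1 by rewrite gdist_eq1.
by rewrite -sz -sn.
Qed.

End Distance.

(** * Intersection numbers *)

Section IntersectionNumbers.
Variables (X : finType) (e : rel X).
Hypotheses (e_sym : symmetric e) (eirr : irreflexive e).
Hypotheses (econn : connected_graph e) (ebip : bipartite e).
Hypothesis (edrg : distance_regular e).
Local Notation d := (gdist e).

(** Every edge changes sides of the bipartition, so a distance is odd exactly when its ends lie on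
    different sides. *)
Lemma gdist_parity y z u : odd (d y z) = odd (d y u) (+) odd (d u z).
Proof.
have [S hS] := ebip.
suff h a b : odd (d a b) = (a \in S) (+) (b \in S).
  by rewrite !h; case: (y \in S); case: (z \in S); case: (u \in S).
have [s [ps <- <-]] := gdist_walk econn a b.
elim: s a ps => [|w s IH] a /=; first by rewrite addbb.
case/andP=> eaw /IH ->; move: (hS _ _ eaw).
by case: (a \in S); case: (w \in S); case: (last w s \in S).
Qed.

Lemma inumE h i j y z : d y z = h -> inum e h i j = pcount e i j y z.
Proof.
rewrite /inum => h_; case: pickP => [[a b] /= /eqP hab|/(_ (y, z))].
  by apply: edrg; rewrite hab.
by rewrite /= h_ eqxx.
Qed.

Lemma gdist_nbr y z w : e y w -> d z w = (d y z).-1 \/ d z w = (d y z).+1.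
Proof.
move=> eyw.
have h1 : d y w = 1%N by apply/eqP; rewrite gdist_eq1.
have := gdist_triangle econn y w z; have := gdist_triangle econn w y z.
have := gdist_parity y z w.
by rewrite (gdist_sym e_sym econn w y) (gdist_sym e_sym econn z w) h1; lia.
Qed.

(** Bipartiteness leaves a neighbour of y only the distances i-1 and i+1 from z, and c_i and b_i
    count the two kinds. This gives both c_i + b_i = k and the action of A on functions of the
    distance. *)
Lemma nbr_sum (R : pzSemiRingType) (F : nat -> R) y z i : d y z = i ->
  \sum_(w | e y w) F (d z w) =
  (cnum e i)%:R * F i.-1 + (bnum e i)%:R * F i.+1.
Proof.
move=> hi; rewrite /cnum /bnum !(inumE _ _ hi) /pcount -!sum1_card !natr_sum.
rewrite !mulr_suml (bigID (fun w => d z w == i.-1)) /=; congr (_ + _).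
  apply: eq_big => [w|w /andP[_ /eqP ->]]; last by rewrite mul1r.
  by rewrite inE gdist_eq1.
apply: eq_big => [w|w /andP[eyw ne]].
  rewrite inE gdist_eq1 //; case eyw: (e y w) => //=.
  by case: (gdist_nbr z eyw); rewrite hi; lia.
by case: (gdist_nbr z eyw) ne => ->; rewrite hi ?mul1r ?eqxx.
Qed.

(** Since [0.-1] is 0, this number counts vertices at distance both 1 and 0 from x. *)
Lemma cnum0 (x : X) : cnum e 0 = 0%N.
Proof.
rewrite /cnum (inumE _ _ (gdistxx e x)) /pcount; apply: eq_card0 => w.
by rewrite !inE /=; lia.
Qed.

Lemma cbnumE k i : regular_of_valency e k -> (exists y z, d y z = i) ->
  (cnum e i + bnum e i = k)%N.
Proof.
move=> ereg [y [z h]]; have := nbr_sum (fun=> 1%N : nat) h.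
rewrite !natn /= !mulr1 -(ereg y) -sum1_card => h1.
by rewrite -[LHS]h1; apply: eq_bigl => w; rewrite inE.
Qed.

Variable D : nat.
Hypothesis ediam : diameter e = D.

Lemma gdist_le_diam y z : (d y z <= D)%N.
Proof.
rewrite -ediam; apply: leq_trans (leq_bigmax y).
exact: (leq_bigmax (F := fun z => d y z) z).
Qed.

Lemma gdist_pair (x : X) i : (i <= D)%N -> exists y z, d y z = i.
Proof.
have X0 : (0 < #|X|)%N by apply/card_gt0P; exists x.
move=> hi; rewrite -(subKn hi); move: (D - i)%N => j.
elim: j => [|j [y [z h]]].
  (* Start at a pair realising the diameter; each further step moves one vertex along a shortest
     walk, lowering the distance by 1. *)
  have [y hy] := bigop.eq_bigmax (I := X) (fun y => \max_z d y z)%N X0.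
  have [z hz] := bigop.eq_bigmax (I := X) (d y) X0.
  by exists y, z; rewrite subn0 -ediam /diameter hy hz.
case: (ltnP j D) => hj; last by exists y, z; rewrite h; lia.
have [u _ hu] := gdist_step eirr econn (n := (D - j.+1)%N) (y := y) (z := z) ltac:(lia).
by exists u, z.
Qed.

Lemma cnum1 (x : X) : (0 < D)%N -> cnum e 1 = 1%N.
Proof.
move=> /(gdist_pair x)[y [z h]]; rewrite /cnum (inumE _ _ h) /pcount /=.
rewrite -[RHS](cards1 z); apply: eq_card => w; rewrite !inE gdist_eq0 // [z == w]eq_sym.
by rewrite andbC; case: (w =P z) => [->|]; rewrite ?h ?eqxx.
Qed.

Lemma cnum_gt0 (x : X) i : (0 < i <= D)%N -> (0 < cnum e i)%N.
Proof.
case: i => // i /(gdist_pair x)[y [z h]].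
rewrite /cnum (inumE _ _ h) card_gt0.
have [u eyu hu] := gdist_step eirr econn h.
by apply/set0Pn; exists u; rewrite inE gdist_eq1 // eyu gdist_sym ?hu /=.
Qed.

Lemma bnum_gt0 (x : X) i : (i < D)%N -> (0 < bnum e i)%N.
Proof.
move=> /(gdist_pair x)[y [z h]]; have [u eyu hu] := gdist_step eirr econn h.
rewrite /bnum (inumE _ _ hu) card_gt0.
apply/set0Pn; exists y; rewrite inE gdist_eq1 // e_sym eyu /=.
by rewrite gdist_sym ?h.
Qed.

End IntersectionNumbers.

(** * Distance matrices and layers *)

Section BoseMesner.
Variables (C : numClosedFieldType) (X : finType) (e : rel X).
Hypotheses (e_sym : symmetric e) (eirr : irreflexive e).
Hypotheses (econn : connected_graph e) (ebip : bipartite e).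
Hypothesis (edrg : distance_regular e).
Local Notation d := (gdist e).
Local Notation A := (Amx C e).
Local Notation c i := ((cnum e i)%:R : C).
Local Notation b i := ((bnum e i)%:R : C).

(** The general element of the Bose-Mesner algebra, given by its value at each distance, so that
    multiplying by A becomes a recurrence on [a]. *)
Definition dist_mx (a : nat -> C) : 'M[C]_#|X| :=
  \matrix_(r, s) a (d (enum_val r) (enum_val s)).

Lemma mul_dist_mx a :
  A 1 *m dist_mx a = dist_mx (fun i => c i * a i.-1 + b i * a i.+1).
Proof.
apply/matrixP => r s; rewrite !mxE.
rewrite -(nbr_sum e_sym eirr econn ebip edrg a (erefl (d _ _))).
rewrite [RHS]big_mkcond [RHS](big_enum_val _ (A := X)) /=.
apply: eq_bigr => j _; rewrite !mxE gdist_eq1 // (gdist_sym e_sym econn _ (enum_val s)).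
by case: e; rewrite ?mul1r ?mul0r.
Qed.

Lemma Amx0 : A 0 = 1%:M.
Proof.
by apply/matrixP => r s; rewrite !mxE gdist_eq0 // (inj_eq enum_val_inj).
Qed.

Lemma Amx_tr h : (A h)^T = A h.
Proof. by apply/matrixP => r s; rewrite !mxE gdist_sym. Qed.

Lemma mulA_Amx h :
  A 1 *m A h.+1 = b h *: A h + c h.+2 *: A h.+2.
Proof.
have -> : A h.+1 = dist_mx (fun i => (i == h.+1)%:R) by [].
rewrite mul_dist_mx; apply/matrixP => r s; rewrite !mxE eqSS.
move: (d _ _) => i; rewrite addrC; congr (_ + _); last first.
  by case: eqP => [->|]; rewrite ?mulr0.
case: i => [|i] /=; first by rewrite !mulr0.
by rewrite eqSS; case: eqP => [->|]; rewrite ?mulr0.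
Qed.

Variable x : X.
Local Notation Es := (Estar C e x).

Lemma EstarE i (u : 'cV[C]_#|X|) r :
  (Es i *m u) r 0 = (d x (enum_val r) == i)%:R * u r 0.
Proof. by rewrite mul_diag_mx !mxE. Qed.

Lemma mul_Estar i j : Es i *m Es j = if i == j then Es i else 0.
Proof.
apply/matrixP => r s; rewrite mul_diag_mx !mxE.
have [<-|ne] := eqVneq i j; rewrite !mxE; first by case: eqP; rewrite ?mul1r ?mul0r // mul0rn.
by case: eqP => [->|_]; rewrite ?mul0r // mul1r (negPf ne) mul0rn.
Qed.

(** Vertices of layers m and n at distance h satisfy the three triangle inequalities through x, and
    m + n + h is even. *)
Lemma Estar_Amx0 m h n (u : 'cV[C]_#|X|) : Es n *m u = u ->
  [|| (n + h < m)%N, (m + h < n)%N, (m + n < h)%N | odd (m + n + h)] ->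
  Es m *m (A h *m u) = 0.
Proof.
move=> hu hh; apply/colP => r; rewrite EstarE !mxE.
case: (d x (enum_val r) =P m) => hm; rewrite ?mul0r // mul1r big1 // => s _.
rewrite mxE -hu EstarE.
case: (d x (enum_val s) =P n) => hn; rewrite ?mul0r ?mulr0 //.
case: (_ =P h) => h'; rewrite ?mul0r //.
have := gdist_triangle econn x (enum_val r) (enum_val s).
have := gdist_triangle econn x (enum_val s) (enum_val r).
have := gdist_triangle econn (enum_val r) x (enum_val s).
have := gdist_parity econn ebip x (enum_val s) (enum_val r).
rewrite (gdist_sym e_sym econn _ x) (gdist_sym e_sym econn (enum_val s)) hm hn h'.
lia.
Qed.

Variable D : nat.
Hypothesis ediam : diameter e = D.

Lemma dist_mx_sum a : \sum_(0 <= h < D.+1) a h *: A h = dist_mx a.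
Proof.
apply/matrixP => r s; rewrite summxE mxE.
set i := d _ _; have hi : (i < D.+1)%N by rewrite ltnS gdist_le_diam.
rewrite big_mkord (bigD1 (Ordinal hi)) //= big1 ?addr0 => [|j ne].
  by rewrite !mxE eqxx mulr1.
rewrite !mxE -/i; case: eqP => [ij|]; rewrite ?mulr0 //.
by case/eqP: ne; apply: val_inj; rewrite /= ij.
Qed.

Lemma dist_mx_eigen a t : A 1 *m dist_mx a = t *: dist_mx a ->
  forall i, (i <= D)%N -> t * a i = c i * a i.-1 + b i * a i.+1.
Proof.
move=> h i /(gdist_pair eirr econn ediam x)[y [z hi]].
have := congr1 (fun M : 'M[C]_#|X| => M (enum_rank y) (enum_rank z)) h.
by rewrite mul_dist_mx !mxE !enum_rankK hi => ->.
Qed.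

Lemma Estar_ext (u w : 'cV[C]_#|X|) :
  (forall i, (i <= D)%N -> Es i *m u = Es i *m w) -> u = w.
Proof.
move=> h; apply/colP => r.
have /colP/(_ r) := h _ (gdist_le_diam ediam x (enum_val r)).
by rewrite !EstarE eqxx !mul1r.
Qed.

Lemma Estar_gt i (u : 'cV[C]_#|X|) : (D < i)%N -> Es i *m u = 0.
Proof.
move=> hi; apply/colP => r; rewrite EstarE mxE.
case: eqP => h; rewrite ?mul0r //.
by have := gdist_le_diam ediam x (enum_val r); rewrite h leqNgt hi.
Qed.

(** As c_{n+2} is nonzero, the recurrence for A A_{n+1} can be solved for A_{n+2}; each A_h is thus
    a polynomial in A. *)
Lemma in_T_Amx h : (h <= D)%N -> in_T e x D (A h).
Proof.
suff H n : ((n <= D)%N -> in_T e x D (A n)) /\ ((n < D)%N -> in_T e x D (A n.+1)).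
  by move/(proj1 (H h)).
elim: n => [|n [IH1 IH2]].
  by split=> _; [rewrite Amx0; apply: in_T_1 | apply: in_T_A].
split=> // hn.
have cn : c n.+2 != 0 by rewrite pnatr_eq0 -lt0n (cnum_gt0 e_sym eirr econn edrg ediam x).
have -> : A n.+2 = (c n.+2)^-1 *: (A 1 *m A n.+1 + (- b n) *: A n).
  by rewrite mulA_Amx scaleNr addrAC subrr add0r scalerA mulVf ?scale1r.
apply/in_T_scale/in_T_add; first by apply: in_T_mul; [apply: in_T_A | apply: IH2; lia].
by apply: in_T_scale; apply: IH1; lia.
Qed.

End BoseMesner.

(** * The polynomials *)

Section Polynomials.
Variables (C : fieldType) (X : finType) (e : rel X) (D k : nat).
Local Notation c i := ((cnum e i)%:R : C).
Local Notation b i := ((bnum e i)%:R : C).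
Local Notation f := (fpoly C e).
Local Notation p := (ppoly C e).
Lemma ppoly0 : p 0 = 1.
Proof. by rewrite /ppoly big_mkcond big_ord1. Qed.

Lemma ppoly1 : p 1 = f 1.
Proof. by rewrite /ppoly big_mkcond big_ord_recl big_ord1 /= add0r. Qed.

Lemma even_sum_recr (V : nmodType) (F : nat -> V) n :
  \sum_(h < n.+3 | ~~ odd (n.+2 - h)) F h =
  \sum_(h < n.+1 | ~~ odd (n - h)) F h + F n.+2.
Proof.
rewrite [LHS]big_mkcond big_ord_recr big_ord_recr /= subnn subSn // subnn /= addr0.
congr (_ + _); rewrite [RHS]big_mkcond; apply: eq_bigr => h _ /=.
by have -> : odd (n.+2 - h) = odd (n - h) by have := ltn_ord h; lia.
Qed.

Lemma ppolySS n : p n.+2 = p n + f n.+2.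
Proof. exact: even_sum_recr. Qed.

Local Notation P t i := (Ppoly C e i).[t].

Lemma Ppoly0 t : P t 0 = 1.
Proof. by rewrite /Ppoly /= ppoly0 -polyC1 even_polyC hornerC. Qed.

Lemma Ppoly1 t : P t 1 = (c 1)^-1.
Proof.
rewrite /Ppoly /= ppoly1 /= odd_polyZ -['X]mul1r odd_polyMX -polyC1 even_polyC.
by rewrite hornerZ hornerC mulr1.
Qed.

Hypotheses (c_neq0 : forall i, (0 < i <= D)%N -> c i != 0).

Lemma fpoly_rec n : (n.+2 <= D)%N -> 'X * f n.+1 = b n *: f n + c n.+2 *: f n.+2.
Proof.
by move=> hn; rewrite [f n.+2]/= scalerA divff ?scale1r ?c_neq0 // addrC subrK.
Qed.

Lemma fpoly_rec0 : (0 < D)%N -> 'X * f 0 = c 1 *: f 1.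
Proof. by move=> hD; rewrite /= scalerA divff ?scale1r ?mulr1 ?c_neq0. Qed.

Hypotheses (b_neq0 : forall i, (i < D)%N -> b i != 0).
Hypothesis (c1E : c 1 = 1).

Lemma knumSS n : (n.+2 <= D)%N ->
  knum C e n.+2 = knum C e n * (b n * b n.+1 / (c n.+1 * c n.+2)).
Proof.
move=> hn; rewrite /knum (big_nat_recr n.+1) // (big_nat_recr n) //.
rewrite (big_nat_recr n.+2) // (big_nat_recr n.+1) //=.
by rewrite !invfM; ring.
Qed.

Lemma knum_neq0 n : (n <= D)%N -> knum C e n != 0.
Proof.
move=> hn; rewrite mulf_neq0 ?invr_eq0 // prodf_seq_neq0; apply/allP => i.
  by rewrite mem_index_iota /= => hi; apply: b_neq0; lia.
by rewrite mem_index_iota /= => hi; apply: c_neq0; lia.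
Qed.

Lemma K_neq0 n : (n.+1 < D)%N -> knum C e n * b n * b n.+1 != 0.
Proof.
by move=> hn; rewrite !(mulIr_eq0 _ (mulIf (b_neq0 _))) ?knum_neq0 //; lia.
Qed.

Lemma gpoly0 psi : (1 < D)%N -> gpoly e psi 0 = p 0.
Proof.
move=> D2; rewrite /gpoly big_mkcond big_ord1 /= Ppoly0 !divff ?mulr1 ?scale1r ?oner_neq0 //.
by rewrite K_neq0 //; lia.
Qed.

Lemma gpoly1 psi : (2 < D)%N -> gpoly e psi 1 = p 1.
Proof.
move=> D2; rewrite /gpoly big_mkcond big_ord_recl big_ord1 /= add0r Ppoly1 c1E.
rewrite !divff ?mulr1 ?scale1r ?invr1 ?oner_neq0 //.
by rewrite K_neq0 //; lia.
Qed.

Hypotheses (cnum_0 : cnum e 0 = 0%N).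
Hypotheses (cbE : forall i, (i <= D)%N -> (cnum e i + bnum e i = k)%N).

(** Adding the recurrence of f_{n+3} to the case n leaves (c_{n+2} + b_{n+2}) p_{n+2} + c_{n+4}
    f_{n+4}. The bracket is k = c_{n+4} + b_{n+4}, which gives the case n+2. *)
Lemma ppoly_rec n : (n.+2 <= D)%N ->
  'X * p n.+1 = c n.+2 *: p n.+2 + b n.+2 *: p n.
Proof.
have kE i : (i <= D)%N -> (k%:R : C) = c i + b i by move/cbE <-; rewrite natrD.
have b0E i : (i <= D)%N -> b i = k%:R - c i by move/kE ->; rewrite addrC addKr.
suff H m : ((m.+2 <= D)%N -> 'X * p m.+1 = c m.+2 *: p m.+2 + b m.+2 *: p m) /\
    ((m.+3 <= D)%N -> 'X * p m.+2 = c m.+3 *: p m.+3 + b m.+3 *: p m.+1).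
  exact: (proj1 (H n)).
elim: m => [|m [IH1 IH2]]; split=> // hm.
- rewrite ppolySS ppoly1 ppoly0 fpoly_rec // !b0E // ?cnum_0.
  by rewrite scalerDr -!mul_polyC polyCB subr0; ring.
- rewrite !ppolySS ppoly1 ppoly0 mulrDr fpoly_rec // -[1]/(f 0) fpoly_rec0 //; last by lia.
  by rewrite !b0E //; [rewrite scalerDr -!mul_polyC !polyCB; ring | lia].
rewrite (ppolySS m.+2) (ppolySS m.+1) mulrDr fpoly_rec // IH1; last by lia.
rewrite scalerDr (ppolySS m) !b0E //; last by lia.
by rewrite !scalerDr -!mul_polyC !polyCB; ring.
Qed.

(** Take the even or odd part of the recurrence for p. The factor t, standing for the square of the
    variable, appears when p_{n+1} is odd, that is, when n is even. *)
Lemma Ppoly_rec t n : (n.+2 <= D)%N ->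
  (if odd n then 1 else t) * P t n.+1 = c n.+2 * P t n.+2 + b n.+2 * P t n.
Proof.
move=> hn; have := ppoly_rec hn; rewrite mulrC /Ppoly /= negbK.
case: (odd n) => /= h.
  have := congr1 (fun q => (odd_poly q).[t]) h.
  by rewrite odd_polyMX odd_polyD !odd_polyZ !hornerE => ->; rewrite ?mul1r.
have := congr1 (fun q => (even_poly q).[t]) h.
by rewrite even_polyMX even_polyD !even_polyZ !hornerE [t * _]mulrC => ->.
Qed.

(* [alpha] and [xi] are the coefficients in p_j(A) v = u_{j+2} + alpha_j u_j and
   A u_{j+2} = c_{j+1} u_{j+3} + xi_j u_{j+1}; the non-vanishing of xi forces
   that of P_j(psi). *)
Section Ratios.
Variables (eta psi : C) (alpha xi : nat -> C).
Hypothesis (D_ge4 : (4 <= D)%N).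
Hypotheses (eta_neq : 1 + eta != 0).
Hypotheses (psiE : psi = b 2 * (1 - b 3 / (1 + eta))).
Hypotheses (alpha1 : alpha 1 = 0) (alpha2 : alpha 2 = 1 + eta).
Hypotheses (xi_neq0 : forall n, (n.+3 <= D)%N -> xi n.+1 != 0).
Hypotheses (xi_eq : forall n, (n.+4 <= D)%N ->
  xi n.+1 + alpha n.+1 * c n = c n.+2 * alpha n.+2 + b n.+2).
Hypotheses (alpha_eq : forall n, (n.+4 < D)%N ->
  alpha n.+3 * xi n.+1 = b n.+4 * alpha n.+2).

(** [Pm] stands for P_{n-1}(psi), and is 0 at the start n = 0. The relation for xi fixes xi_{n+1}
    from two known alphas; its non-vanishing gives P_{n+3}(psi) <> 0, and the second relation then
    gives alpha_{n+3}. *)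
Lemma alpha_Ppoly_step n (Pm : C) : (n.+4 < D)%N ->
  (if odd n then psi else 1) * P psi n = c n.+1 * P psi n.+1 + b n.+1 * Pm ->
  alpha n.+1 * (c n * c n.+1 * P psi n.+1) = - (b n.+1 * b n.+2 * Pm) ->
  alpha n.+2 * (c n.+1 * c n.+2 * P psi n.+2) =
    - (b n.+2 * b n.+3 * P psi n) ->
  P psi n != 0 -> P psi n.+1 != 0 -> P psi n.+2 != 0 ->
  P psi n.+3 != 0 /\
  alpha n.+3 * (c n.+2 * c n.+3 * P psi n.+3) =
    - (b n.+3 * b n.+4 * P psi n.+1).
Proof.
move=> hn recn h1 h2 P0 P1 P2.
have recn2 := @Ppoly_rec psi n.+1 ltac:(lia).
have hx := xi_eq (n := n) ltac:(lia).
(* The closed form of xi_{n+1}, with denominators cleared. *)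
have E : c n.+1 * P psi n.+1 * P psi n.+2 * xi n.+1 =
         b n.+2 * c n.+3 * P psi n.+3 * P psi n.
  have -> : xi n.+1 = c n.+2 * alpha n.+2 + b n.+2 - alpha n.+1 * c n.
    by rewrite -hx addrK.
  have -> : c n.+1 * P psi n.+1 * P psi n.+2 *
      (c n.+2 * alpha n.+2 + b n.+2 - alpha n.+1 * c n) =
    P psi n.+1 * (alpha n.+2 * (c n.+1 * c n.+2 * P psi n.+2)) +
    b n.+2 * c n.+1 * P psi n.+1 * P psi n.+2 -
    P psi n.+2 * (alpha n.+1 * (c n * c n.+1 * P psi n.+1)) by ring.
  rewrite h1 h2; apply/eqP; rewrite -subr_eq0; apply/eqP.
  transitivity (b n.+2 *
    (P psi n.+2 * (c n.+1 * P psi n.+1 + b n.+1 * Pm) -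
     P psi n * (c n.+3 * P psi n.+3 + b n.+3 * P psi n.+1))); first by ring.
  by rewrite -recn -recn2 /=; case: (odd n) => /=; ring.
have xn := xi_neq0 (n := n) ltac:(lia).
have cn i : (i < D)%N -> c i.+1 != 0 by move=> hi; apply: c_neq0.
have P3 : P psi n.+3 != 0.
  apply: contraNneq xn => h; move: E; rewrite h mulr0 mul0r => /eqP.
  by rewrite !mulf_eq0 (negPf P1) (negPf P2) (negPf (cn n _)) //; lia.
(* Multiplying by b_{n+2} P_n(psi) makes the right side of [E] appear, hence the product alpha_{n+3}
   xi_{n+1}. *)
split=> //; have bn : b n.+2 != 0 by apply: b_neq0; lia.
apply: (mulfI bn); apply: (mulfI P0).
transitivity (c n.+2 * (alpha n.+3 * (b n.+2 * c n.+3 * P psi n.+3 * P psi n))).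
  by ring.
rewrite -E.
transitivity (c n.+2 * c n.+1 * P psi n.+1 * P psi n.+2 * (alpha n.+3 * xi n.+1)).
  by ring.
rewrite alpha_eq //.
transitivity (b n.+4 * P psi n.+1 * (alpha n.+2 * (c n.+1 * c n.+2 * P psi n.+2))).
  by ring.
by rewrite h2; ring.
Qed.

Lemma alpha_Ppoly n : (n.+4 <= D)%N ->
  P psi n.+2 != 0 /\
  alpha n.+2 * (c n.+1 * c n.+2 * P psi n.+2) = - (b n.+2 * b n.+3 * P psi n).
Proof.
have c1 : P psi 1 = 1 by rewrite Ppoly1 c1E invr1.
(* This explains the choice of psi: c_2 P_2(psi) = psi - b_2 has to equal - b_2 b_3 / alpha_2, with
   alpha_2 = 1 + eta. *)
have P2 : c 2 * P psi 2 = - (b 2 * b 3 / (1 + eta)).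
  have := @Ppoly_rec psi 0 ltac:(lia).
  rewrite /= c1 Ppoly0 !mulr1 => /eqP; rewrite -subr_eq => /eqP <-.
  by rewrite psiE; field.
have b23 : b 2 * b 3 != 0 by rewrite mulf_neq0 // b_neq0 //; lia.
have H0 : P psi 2 != 0 /\
    alpha 2 * (c 1 * c 2 * P psi 2) = - (b 2 * b 3 * P psi 0).
  split; last by rewrite alpha2 c1E mul1r P2 Ppoly0; field.
  have : c 2 * P psi 2 != 0 by rewrite P2 oppr_eq0 mulf_neq0 // invr_eq0.
  by rewrite mulf_eq0 negb_or => /andP[].
(* Strengthened to carry all the data that the induction step consumes, including a value for
   P_{n-1}(psi). *)
suff H : (n.+4 <= D)%N -> [/\ P psi n != 0, P psi n.+1 != 0,
    P psi n.+2 != 0 & alpha n.+2 * (c n.+1 * c n.+2 * P psi n.+2) =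
      - (b n.+2 * b n.+3 * P psi n)] /\ (exists2 Pm,
    (if odd n then psi else 1) * P psi n = c n.+1 * P psi n.+1 + b n.+1 * Pm &
    alpha n.+1 * (c n * c n.+1 * P psi n.+1) = - (b n.+1 * b n.+2 * Pm)).
  by case/H => [[]].
elim: n => [|n IH] hn.
  split; first by case: H0; rewrite c1 Ppoly0 oner_neq0.
  exists 0; first by rewrite /= Ppoly0 c1 c1E mulr0 addr0.
  by rewrite alpha1 mul0r mulr0 oppr0.
have [[P0 P1 P2' h2] [Pm rec h1]] := IH ltac:(lia).
have [P3 h3] := alpha_Ppoly_step hn rec h1 h2 P0 P1 P2'.
split=> //; exists (P psi n) => //.
by have <- := @Ppoly_rec psi n ltac:(lia); rewrite /=; case: (odd n).
Qed.

Local Notation g := (gpoly e psi).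

(** For h <= n, the coefficients of p_h in g_{n+2} and g_n have a ratio independent of h, namely
    b_{n+2} b_{n+3} P_n(psi) / (c_{n+1} c_{n+2} P_{n+2}(psi)) = - alpha_{n+2}. *)
Lemma gpolySS n : (n.+4 <= D)%N -> g n.+2 = p n.+2 - alpha n.+2 *: g n.
Proof.
move=> hn; pose F h := (P psi h / P psi n.+2 * ((knum C e n.+2 * b n.+2 * b n.+3) /
  (knum C e h * b h * b h.+1))) *: p h.
rewrite [g n.+2](even_sum_recr F) /gpoly {}/F.
have [P2 hal] := alpha_Ppoly hn.
have bn i : (i < n.+4)%N -> b i != 0 by move=> hi; apply: b_neq0; lia.
have cn i : (i < n.+4)%N -> c i.+1 != 0 by move=> hi; apply: c_neq0; lia.
rewrite !divff ?K_neq0 // ?mulr1 ?scale1r // addrC; congr (_ + _).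
rewrite scaler_sumr -sumrN; apply: eq_bigr => h _.
rewrite scalerA -scaleNr; congr (_ *: _).
have P0 : P psi n != 0.
  case: n hn {P2 hal bn cn h} => [|[|n]] hn; first by rewrite Ppoly0 oner_neq0.
    by rewrite Ppoly1 c1E invr1 oner_neq0.
  by have [] := @alpha_Ppoly n ltac:(lia).
have [c1' c2'] := (cn n ltac:(lia), cn n.+1 ltac:(lia)).
have -> : alpha n.+2 =
    - (b n.+2 * b n.+3 * P psi n) / (c n.+1 * c n.+2 * P psi n.+2).
  by rewrite -hal mulfK // !(mulf_neq0 _ P2) // mulf_neq0.
rewrite knumSS; last by lia.
set K := (knum C e h * _ * _)^-1; clearbody K.
by field; rewrite P0 P2 c1' c2'.
Qed.

End Ratios.
End Polynomials.

(** * Spectrum *)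

Section Spectrum.
Variables (C : numClosedFieldType) (X : finType) (e : rel X) (D k : nat).
Variables (theta : nat -> C) (x : X).
Hypotheses (e_sym : symmetric e) (eirr : irreflexive e).
Hypotheses (econn : connected_graph e) (ebip : bipartite e).
Hypotheses (ereg : regular_of_valency e k).
Hypotheses (thetaP : ordered_eigenvalues e D theta).
Local Notation A := (Amx C e).
Local Notation V r := (enum_val r : X).

Lemma sum_Amx1 r : \sum_s A 1 r s = k%:R.
Proof.
under eq_bigr do rewrite mxE gdist_eq1 //.
rewrite -(ereg (V r)) -sum1_card natr_sum [RHS]big_mkcond /=.
rewrite [RHS](big_enum_val _ (A := X)) /=.
by apply: eq_bigr => s _; rewrite inE; case: (e _ _).
Qed.

Lemma Amx1_sym r s : A 1 r s = A 1 s r.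
Proof. by rewrite -[in LHS](Amx_tr C e_sym econn) mxE. Qed.

Lemma eigenvalue_valency : eigenvalue (A 1) k%:R.
Proof.
apply/eigenvalueP; exists (const_mx 1).
  apply/rowP => s; rewrite !mxE mulr1 -(sum_Amx1 s).
  by apply: eq_bigr => r _; rewrite [const_mx _ _ _]mxE mul1r Amx1_sym.
apply/eqP => /rowP/(_ (enum_rank x)); rewrite !mxE => /eqP.
by rewrite oner_eq0.
Qed.

(** Changing the sign of an eigenvector on one side of the bipartition negates its eigenvalue. *)
Lemma eigenvalue_opp t : eigenvalue (A 1) t -> eigenvalue (A 1) (- t).
Proof.
have [S hS] := ebip; case/eigenvalueP => u hu u0.
apply/eigenvalueP; exists (\row_s ((-1) ^+ (V s \in S) * u 0 s)).
  apply/rowP => s; rewrite !mxE.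
  transitivity (- (-1) ^+ (V s \in S) * (u *m A 1) 0 s).
    rewrite mxE mulr_sumr; apply: eq_bigr => r _.
    rewrite !mxE gdist_eq1 //; case ers: (e _ _); last by rewrite !mulr0.
    have := hS _ _ ers; rewrite !mulr1.
    by case: (V r \in S); case: (V s \in S) => //= _; rewrite ?expr0 ?expr1 ?opprK.
  by rewrite hu mxE; ring.
apply: contraNneq u0 => /rowP h; apply/eqP/rowP => s.
by move/eqP: (h s); rewrite !mxE mulf_eq0 signr_eq0 => /eqP.
Qed.

(** Compare the sums of the absolute values of the entries of u A = t u: every row of A sums to
    k. *)
Lemma eigenvalue_bound t : eigenvalue (A 1) t -> `|t| <= k%:R.
Proof.
case/eigenvalueP => u hu u0.
have u_gt0 : 0 < \sum_s `|u 0 s|.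
  rewrite lt_neqAle sumr_ge0 ?andbT //; apply: contraNneq u0 => /esym h.
  apply/eqP/rowP => s; rewrite mxE; apply/eqP; rewrite -normr_eq0; apply/eqP.
  by apply: (psumr_eq0P _ h).
rewrite -(ler_pM2r u_gt0) mulr_sumr.
apply: (@le_trans _ _ (\sum_s \sum_r `|u 0 r| * A 1 r s)).
  apply: ler_sum => s _; rewrite -normrM.
  have -> : t * u 0 s = (u *m A 1) 0 s by rewrite hu mxE.
  rewrite mxE; apply: le_trans (ler_norm_sum _ _ _) _; apply: ler_sum => r _.
  by rewrite normrM [A 1 r s]mxE normr_nat.
rewrite exchange_big mulr_sumr; apply: ler_sum => r _.
by rewrite -mulr_sumr sum_Amx1 mulrC.
Qed.

Lemma theta_lt i j : (i < j)%N -> (j <= D)%N -> theta j < theta i.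
Proof. by move=> ij jD; apply: (proj1 thetaP); rewrite ij. Qed.

Lemma theta_le i j : (i <= j)%N -> (j <= D)%N -> theta j <= theta i.
Proof.
by rewrite leq_eqVlt => /orP[/eqP->//|ij jD]; apply/ltW/theta_lt.
Qed.

Lemma theta_eigen i : (i <= D)%N -> eigenvalue (A 1) (theta i).
Proof. by move=> hi; apply/(proj2 thetaP); exists i. Qed.

(** The spectrum is symmetric about 0, and two strictly increasing lists with the same members
    coincide. *)
Lemma theta_opp i : (i <= D)%N -> theta (D - i) = - theta i.
Proof.
move=> hi; pose s1 := mkseq (fun j => theta (D - j)) D.+1.
pose s2 := mkseq (fun j => - theta j) D.+1.
suff s12 : s1 = s2.
  by have := congr1 (fun s => s`_i) s12; rewrite !nth_mkseq.
have mem1 y : y \in s1 <-> eigenvalue (A 1) y.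
  rewrite (proj2 thetaP); split=> [/mapP[j hj ->]|[j hj ->]].
    by exists (D - j)%N => //; apply: leq_subr.
  apply/mapP; exists (D - j)%N; last by rewrite subKn.
  by rewrite mem_iota /=; lia.
have mem2 y : y \in s2 <-> eigenvalue (A 1) y.
  split=> [/mapP[j hj ->]|].
    by apply/eigenvalue_opp/theta_eigen; move: hj; rewrite mem_iota.
  move/eigenvalue_opp/(proj2 thetaP) => [j hj yj].
  apply/mapP; exists j; first by rewrite mem_iota.
  by rewrite -yj opprK.
apply: lt_sorted_eq.
- apply/(sortedP 0) => j; rewrite size_mkseq => hj.
  by rewrite !nth_mkseq //; [apply: theta_lt; lia | lia].
- apply/(sortedP 0) => j; rewrite size_mkseq => hj.
  by rewrite !nth_mkseq //; [rewrite ltrN2; apply: theta_lt; lia | lia].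
by move=> y; apply/idP/idP => [/mem1/mem2|/mem2/mem1].
Qed.

Lemma theta0E : theta 0 = k%:R.
Proof.
have [i hi hk] := (proj2 thetaP _).1 eigenvalue_valency.
have k_le : k%:R <= theta 0 by rewrite hk; apply: theta_le.
apply/eqP; rewrite eq_le k_le andbT.
have /eigenvalue_bound := theta_eigen (leq0n D).
by rewrite ger0_norm //; apply: le_trans k_le.
Qed.

Lemma thetaDE : theta D = - k%:R.
Proof. by rewrite -theta0E -theta_opp // subn0. Qed.

(** By symmetry of the spectrum theta_j lies between -theta_i = theta_{D-i} and theta_i. *)
Lemma theta_sq_le i j : (i <= j <= D - i)%N -> (i <= D./2)%N ->
  theta j ^+ 2 <= theta i ^+ 2.
Proof.
move=> /andP[ij ji] hi.
have h1 : theta j <= theta i by apply: theta_le; lia.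
have h2 : - theta i <= theta j.
  by rewrite -theta_opp; [apply: theta_le; lia | lia].
rewrite -subr_ge0 subr_sqr mulr_ge0 ?subr_ge0 //.
by rewrite -[theta j]opprK subr_ge0 lerNl.
Qed.

Lemma theta_half_ge0 i : (i <= D./2)%N -> 0 <= theta i.
Proof.
move=> hi; have : - theta i <= theta i.
  by rewrite -theta_opp; [apply: theta_le; lia | lia].
by rewrite -subr_ge0 opprK -mulr2n pmulrn_lge0.
Qed.

Lemma theta_half_sq_le j : (j <= D)%N -> theta D./2 ^+ 2 <= theta j ^+ 2.
Proof.
move=> hj; have [h|h] := leqP j D./2.
  by apply: theta_sq_le; lia.
rewrite -[leRHS]sqrrN -theta_opp //.
by apply: theta_sq_le; lia.
Qed.

Lemma theta_sq_lt j : (0 < j < D)%N -> theta j ^+ 2 < k%:R ^+ 2.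
Proof.
move=> hj.
have h1 : theta j < k%:R by rewrite -theta0E; apply: theta_lt; lia.
have h2 : - k%:R < theta j by rewrite -thetaDE; apply: theta_lt; lia.
rewrite -subr_gt0 subr_sqr mulr_gt0 ?subr_gt0 //.
by rewrite -[theta j]opprK subr_gt0 ltrNl.
Qed.

End Spectrum.

(** * Action of the Bose-Mesner algebra on a layer-2 vector with entry sum 0 *)

Section Components.
Variables (C : numClosedFieldType) (X : finType) (e : rel X).
Variables (x : X).
Hypotheses (e_sym : symmetric e) (eirr : irreflexive e).
Hypotheses (econn : connected_graph e) (ebip : bipartite e).
Local Notation d := (gdist e).
Local Notation V r := (enum_val r : X).
Local Notation A := (Amx C e).
Local Notation c i := ((cnum e i)%:R : C).
Local Notation b i := ((bnum e i)%:R : C).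
Local Notation Es := (Estar C e x).
Variable (v : 'cV[C]_#|X|).
Hypotheses (v2 : Es 2 *m v = v) (v_sum : \sum_s v s 0 = 0).

(** Two vertices of layer 2 are at distance 0, 2 or 4. On that layer A_0 and A_2 give v and eta v,
    and since the entries of v sum to 0, A_4 gives -(1 + eta) v. *)
Lemma dist_mx_layer2 (a : nat -> C) (eta : C) : Es 2 *m (A 2 *m v) = eta *: v ->
  Es 2 *m (dist_mx e a *m v) = (a 0 + eta * a 2 - (1 + eta) * a 4) *: v.
Proof.
move=> hA; apply/colP => r; have := congr1 (fun u : 'cV[C]_#|X| => u r 0) hA.
rewrite !EstarE !mxE; have vE s : v s 0 = (d x (V s) == 2%N)%:R * v s 0.
  by rewrite -{1}v2 EstarE.
case hr: (d x (V r) == 2%N); last by rewrite vE hr !mul0r !mulr0.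
rewrite !mul1r => h2.
transitivity (\sum_s (a 4 * v s 0 + (a 2 - a 4) * (A 2 r s * v s 0) +
    (a 0 - a 4) * ((s == r)%:R * v s 0))).
  apply: eq_bigr => s _; rewrite !mxE vE.
  case hs: (d x (V s) == 2%N); last by rewrite !mul0r !mulr0 !addr0.
  have : d (V r) (V s) \in [:: 0; 2; 4]%N.
    have := gdist_triangle econn (V r) x (V s).
    have := gdist_parity econn ebip (V r) (V s) x.
    rewrite (gdist_sym e_sym econn (V r) x) (eqP hr) (eqP hs).
    by rewrite !inE; move: (d _ _) => n; lia.
  have <- : (d (V r) (V s) == 0%N) = (s == r).
    by rewrite gdist_eq0 // (inj_eq enum_val_inj) eq_sym.
  by rewrite !inE => /or3P[] /eqP ->; rewrite /=; ring.
rewrite !big_split /= -!mulr_sumr v_sum h2.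
have -> : \sum_s (s == r)%:R * v s 0 = v r 0.
  rewrite (bigD1 r) //= eqxx mul1r big1 ?addr0 // => s /negPf ->.
  by rewrite mul0r.
by ring.
Qed.

Variables D k : nat.
Hypotheses (edrg : distance_regular e) (ediam : diameter e = D).
Hypotheses (ereg : regular_of_valency e k).

Lemma cnum_add_bnum i : (i <= D)%N -> (cnum e i + bnum e i = k)%N.
Proof. by move=> hi; apply: cbnumE (ereg) (gdist_pair eirr econn ediam x hi). Qed.

Lemma bnum_neq0 i : (i < D)%N -> b i != 0.
Proof. by move=> hi; rewrite pnatr_eq0 -lt0n (bnum_gt0 e_sym eirr econn edrg ediam x). Qed.

(** The eigenvalue s k forces a_i = s^i a_0, which depends only on the parity of i. Each row is then
    constant on layer 2, and v sums to 0 there. It serves for E_0 and E_D. *)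
Lemma dist_mx_sign (a : nat -> C) (s : C) : s ^+ 2 = 1 ->
  A 1 *m dist_mx e a = (s * k%:R) *: dist_mx e a -> dist_mx e a *m v = 0.
Proof.
move=> s2 /(dist_mx_eigen e_sym eirr econn ebip edrg x ediam) rec.
have aS i : (i < D)%N -> a i.+1 = s * a i.
  elim: i => [|i IH] hi; apply: (mulfI (bnum_neq0 hi)).
    have := rec 0 (ltnW hi); have := @cnum_add_bnum 0 (ltnW hi).
    by rewrite (cnum0 edrg x) add0n mul0r add0r => -> <-; ring.
  have kE : k%:R = c i.+1 + b i.+1 by rewrite -natrD cnum_add_bnum // ltnW.
  have := rec _ (ltnW hi); rewrite kE /= IH => [h|]; last exact: ltnW.
  transitivity (s * (c i.+1 + b i.+1) * (s * a i) - c i.+1 * a i).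
    by rewrite h; ring.
  transitivity (s ^+ 2 * (c i.+1 + b i.+1) * a i - c i.+1 * a i); first by ring.
  by rewrite s2; transitivity (s ^+ 2 * b i.+1 * a i); [rewrite s2|]; ring.
have aE i : (i <= D)%N -> a i = s ^+ i * a 0.
  elim: i => [|i IH] hi; first by rewrite mul1r.
  by rewrite aS // IH 1?ltnW // exprS mulrA.
have sE n : s ^+ n = s ^+ odd n.
  by rewrite -{1}(odd_double_half n) exprD -mul2n exprM s2 expr1n mulr1.
apply/colP => r; rewrite !mxE.
transitivity (\sum_i (s ^+ d (V r) x * a 0) * v i 0); last by rewrite -mulr_sumr v_sum mulr0.
apply: eq_bigr => i _; rewrite mxE -v2 EstarE.
case hi: (d x (V i) == 2%N); last by rewrite !mul0r !mulr0.
rewrite aE ?gdist_le_diam //; congr (_ * _ * _); rewrite sE [RHS]sE.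
by rewrite (gdist_parity econn ebip (V r) (V i) x) (eqP hi) addbF.
Qed.

Lemma dist_mx_first_neq0 (a : nat -> C) t : A 1 *m dist_mx e a = t *: dist_mx e a ->
  dist_mx e a != 0 -> a 0 != 0.
Proof.
move=> /(dist_mx_eigen e_sym eirr econn ebip edrg x ediam) rec.
apply: contraNneq => a0.
suff aE i : (i <= D)%N -> a i = 0.
  by apply/eqP/matrixP => r s; rewrite !mxE aE ?gdist_le_diam.
suff H n : ((n <= D)%N -> a n = 0) /\ ((n < D)%N -> a n.+1 = 0) by exact: (proj1 (H i)).
elim: n => [|n [IH1 IH2]]; split=> // h; apply: (mulfI (bnum_neq0 h)); rewrite mulr0.
  by have := rec 0 (ltnW h); rewrite /= a0 !mulr0 add0r.
by have := rec _ (ltnW h); rewrite /= IH1 1?IH2 ?mulr0 ?add0r // ltnW // ltnW.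
Qed.

(** Write the first factor as (a_0 - a_2) + (1 + eta) (a_2 - a_4). The recurrence for a expresses
    a_2 - a_4 through a_0 - a_2 ([E2]) and a_0 - a_2 through a_0 ([E1]). *)
Lemma cosine_identity (a : nat -> C) (t eta : C) : (4 <= D)%N ->
  A 1 *m dist_mx e a = t *: dist_mx e a ->
  (a 0 + eta * a 2 - (1 + eta) * a 4) * (b 2 * b 3 * k%:R * b 1) =
  a 0 * (k%:R ^+ 2 - t ^+ 2) * (b 2 * b 3 + (1 + eta) * (t ^+ 2 - b 2)).
Proof.
move=> D4 /(dist_mx_eigen e_sym eirr econn ebip edrg x ediam) rec.
have kE i : (i <= D)%N -> c i = k%:R - b i.
  by move=> hi; rewrite -(cnum_add_bnum hi) natrD addrK.
have h0 := rec 0 (leq0n D); have h1 := rec 1%N ltac:(lia).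
have h2 := rec 2 ltac:(lia); have h3 := rec 3 ltac:(lia).
have b0 : b 0 = k%:R by rewrite -(@cnum_add_bnum 0) // (cnum0 edrg x).
have b1 : b 1 = k%:R - 1.
  by rewrite -(@cnum_add_bnum 1); [rewrite natrD (cnum1 eirr econn edrg ediam x); [ring | lia] | lia].
move: h0 h1 h2 h3; rewrite /= (cnum0 edrg x) (cnum1 eirr econn edrg ediam x); last by lia.
rewrite b0 b1 (kE 2) ?(kE 3); [|lia..].
move: (a 0) (a 1) (a 2) (a 3) (a 4) (b 2) (b 3) (k%:R : C).
move=> a0 a1 a2 a3 a4 B2 B3 K h0 h1 h2 h3.
have h0' : K * a1 = t * a0 by rewrite h0; ring.
have h1' : t * a1 = a0 + (K - 1) * a2 by rewrite h1; ring.
have h2' : B2 * a3 = t * a2 - (K - B2) * a1 by rewrite h2; ring.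
have h3' : B3 * a4 = t * a3 - (K - B3) * a2 by rewrite h3; ring.
have E1 : K * (K - 1) * (a0 - a2) = (K ^+ 2 - t ^+ 2) * a0.
  transitivity (K * (K * a0 - (a0 + (K - 1) * a2))); first by ring.
  rewrite -h1'; transitivity (K ^+ 2 * a0 - t * (K * a1)); first by ring.
  by rewrite h0'; ring.
have E2 : B2 * B3 * (a2 - a4) = (a0 - a2) * (t ^+ 2 - B2).
  transitivity (B2 * B3 * a2 - B2 * (B3 * a4)); first by ring.
  rewrite h3'; transitivity (B2 * K * a2 - t * (B2 * a3)); first by ring.
  rewrite h2'; transitivity (B2 * K * a2 - t ^+ 2 * a2 + t * (K * a1) - B2 * (t * a1)).
    by ring.
  by rewrite h0' h1'; ring.
transitivity (B2 * B3 * (K * (K - 1) * (a0 - a2)) +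
   (1 + eta) * (K * (K - 1)) * (B2 * B3 * (a2 - a4))); first by ring.
rewrite E2; transitivity (K * (K - 1) * (a0 - a2) *
  (B2 * B3 + (1 + eta) * (t ^+ 2 - B2))); first by ring.
by rewrite E1; ring.
Qed.

End Components.

(** * The thin module *)

(* The scalar a such that w = a u, if there is one; 0 if u = 0. *)
Definition coef_on (C : fieldType) (n : nat) (u w : 'cV[C]_n) : C :=
  if [pick r | u r 0 != 0] is Some r then w r 0 / u r 0 else 0.

Lemma coef_onE (C : fieldType) (n : nat) (u w : 'cV[C]_n) :
  (exists a, w = a *: u) -> w = coef_on u w *: u.
Proof.
case=> a ->; rewrite /coef_on; case: pickP => [r ur|u0].
  by rewrite mxE mulfK.
apply/colP => r; have /negbFE/eqP h := u0 r.
by rewrite !mxE h !mulr0.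
Qed.

Section ThinModule.
Variables (C : numClosedFieldType) (X : finType) (e : rel X) (D k : nat).
Variables (x : X) (W : {vspace 'cV[C]_#|X|}).
Hypotheses (e_sym : symmetric e) (eirr : irreflexive e).
Hypotheses (econn : connected_graph e) (ebip : bipartite e).
Hypotheses (edrg : distance_regular e) (ediam : diameter e = D).
Hypotheses (Wmod : Tmodule e x D W) (Wthin : thin e x D W).
Hypotheses (Wend : has_endpoint e x W 2).
Local Notation d := (gdist e).
Local Notation V r := (enum_val r : X).
Local Notation A := (Amx C e).
Local Notation c i := ((cnum e i)%:R : C).
Local Notation b i := ((bnum e i)%:R : C).
Local Notation Es := (Estar C e x).

Lemma cnum_neq0 i : (0 < i <= D)%N -> c i != 0.
Proof. by move=> hi; rewrite pnatr_eq0 -lt0n (cnum_gt0 e_sym eirr econn edrg ediam x). Qed.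

Lemma EstarVP i u : reflect (exists2 w, w \in W & u = Es i *m w) (u \in EstarV e x i W).
Proof.
apply: (iffP memv_imgP) => -[w wW ->]; exists w => //.
  by rewrite lfunE.
by rewrite lfunE.
Qed.

Lemma Estar_id i u : u \in EstarV e x i W -> Es i *m u = u.
Proof. by case/EstarVP => w _ ->; rewrite mulmxA mul_Estar eqxx. Qed.

Lemma Estar_mem i u : (i <= D)%N -> u \in W -> Es i *m u \in W.
Proof. by move=> hi; apply: Wmod; apply: in_T_Estar. Qed.

Lemma Amx_mem i u : (i <= D)%N -> u \in W -> A i *m u \in W.
Proof. by move=> hi; apply/Wmod/in_T_Amx. Qed.

Lemma Estar_lt2 i u : (i < 2)%N -> u \in W -> Es i *m u = 0.
Proof.
move=> hi uW; apply/eqP; rewrite -memv0 -((proj2 Wend) i hi).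
by apply/EstarVP; exists u.
Qed.

(** By thinness a nonzero u in E*_i W spans it. *)
Lemma thin_scalar i u w : (i <= D)%N -> u \in W -> w \in W -> Es i *m u = u ->
  u != 0 -> exists a, Es i *m w = a *: u.
Proof.
move=> hi uW wW iu u0; apply/vlineP.
suff -> : (<[u]> = EstarV e x i W)%VS by apply/EstarVP; exists w.
apply/eqP; rewrite eqEdim dim_vline u0 Wthin // andbT -memvE.
by apply/EstarVP; exists u.
Qed.

Lemma Estar_Amx1 m (u : 'cV[C]_#|X|) :
  Es m.+1 *m (A 1 *m u) =
  Es m.+1 *m (A 1 *m (Es m *m u)) + Es m.+1 *m (A 1 *m (Es m.+2 *m u)).
Proof.
rewrite -mulmxDr -mulmxDr; apply/colP => r; rewrite !EstarE.
case: eqP => hr; rewrite ?mul0r // !mul1r !mxE; apply: eq_bigr => s _.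
rewrite [X in _ = _ * X]mxE !EstarE mxE gdist_eq1 //.
case ers: (e _ _); last by rewrite !mul0r.
have [] := gdist_nbr e_sym eirr econn ebip x ers;
  rewrite (gdist_sym e_sym econn _ x) hr => -> /=.
  by rewrite eqxx ltn_eqF ?mulr1n ?mulr0n ?mul0r ?addr0 ?mul1r //; lia.
by rewrite eqxx gtn_eqF ?mulr1n ?mulr0n ?mul0r ?add0r ?mul1r //; lia.
Qed.

Variables (v : 'cV[C]_#|X|) (eta : C).
Hypotheses (vE2 : v \in EstarV e x 2 W) (D_ge4 : (4 <= D)%N).

Lemma layer_v : Es 2 *m v = v. Proof. exact: Estar_id. Qed.

Lemma v_mem : v \in W.
Proof. by case/EstarVP: vE2 => w wW ->; apply: Estar_mem => //; lia. Qed.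

(** The sum is the entry of A_2 v at x, which vanishes because A_2 v is in W and E*_0 W = 0. *)
Lemma v_sum : \sum_s v s 0 = 0.
Proof.
have := @Estar_lt2 0 (A 2 *m v) isT; rewrite Amx_mem ?v_mem //; last by lia.
move=> /(_ isT)/colP/(_ (enum_rank x)); rewrite EstarE mxE enum_rankK
  gdistxx mul1r mxE => h.
rewrite -[RHS]h; apply: eq_bigr => s _.
by rewrite mxE enum_rankK -layer_v EstarE; case: eqP; rewrite ?mul0r ?mulr0 ?mul1r.
Qed.

Hypothesis eta_eigen : local_eigenvalue e x W eta.

Lemma v_eta : Es 2 *m (A 2 *m v) = eta *: v.
Proof.
case: eta_eigen => u [uE u0 hu].
have uW : u \in W by case/EstarVP: uE => w wW ->; apply: Estar_mem => //; lia.
have [a va] := @thin_scalar 2 u v ltac:(lia) uW v_mem (Estar_id uE) u0.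
rewrite layer_v in va.
rewrite -mulmxA (Estar_id uE) -mulmxA in hu.
by rewrite va -!scalemxAr hu !scalerA mulrC.
Qed.

(** * Layer vectors and the tridiagonal action of A on them *)

(* Indexed by the layer it lives in: u_{i+2} is the vector E*_{i+2} A_i v. *)
Definition layer_vec i : 'cV[C]_#|X| :=
  if i is i'.+2 then Es i *m (A i' *m v) else 0.
Local Notation u := layer_vec.

Lemma layer_vec2 : u 2 = v.
Proof. by rewrite /u Amx0 // mul1mx layer_v. Qed.

Lemma Estar_layer_vec i j : Es i *m u j = if i == j then u j else 0.
Proof.
case: j => [|[|j]]; rewrite ?mulmx0 ?if_same //.
by rewrite /u mulmxA mul_Estar; case: eqP => [->|]; rewrite ?mul0mx.
Qed.

Lemma layer_vec_mem i : u i \in W.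
Proof.
case: i => [|[|i]]; rewrite ?mem0v // /u.
have [h|h] := leqP i.+2 D; last by rewrite (Estar_gt x ediam) ?mem0v.
by apply: Estar_mem => //; apply: Amx_mem v_mem; lia.
Qed.

(** With i = j + 2: A_j v has no part in layer j + 4, so u_i may be replaced by A_j v; of the terms
    of A A_j only c_{j+1} A_{j+1} reaches layer j + 3. *)
Lemma raise_layer_vec i : (i <= D)%N -> Es i.+1 *m (A 1 *m u i) = c i.-1 *: u i.+1.
Proof.
case: i => [|[|i]] hi /=; rewrite ?mulmx0 ?scaler0 //.
  by rewrite (cnum0 edrg x) scale0r.
have h1 : Es i.+4 *m (A i *m v) = 0.
  by apply: (Estar_Amx0 e_sym econn ebip layer_v); apply/orP; left; lia.
have := Estar_Amx1 i.+2 (A i *m v); rewrite h1 !mulmx0 addr0 => <-.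
case: i {h1} hi => [|i] hi.
  by rewrite Amx0 // mul1mx (cnum1 eirr econn edrg ediam x) ?scale1r //; lia.
rewrite [A 1 *m _]mulmxA (mulA_Amx C e_sym eirr econn ebip edrg) mulmxDl.
rewrite mulmxDr -!scalemxAl -!scalemxAr.
rewrite (Estar_Amx0 e_sym econn ebip layer_v) ?scaler0 ?add0r //.
by apply/orP; left; lia.
Qed.

Definition lower_coef i := coef_on (u i.+1) (Es i.+1 *m (A 1 *m u i.+2)).
Local Notation xi := lower_coef.

(** From layer 2 on, thinness applies; below the endpoint both sides are 0, which is why the premise
    is an implication. *)
Lemma lower_layer_vec i : (i <= D)%N -> (2 <= i)%N ==> (u i != 0) ->
  Es i *m (A 1 *m u i.+1) = xi i.-1 *: u i.
Proof.
have AuW : A 1 *m u i.+1 \in W by apply: Amx_mem (layer_vec_mem _); lia.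
case: i AuW => [|[|i]] AuW hi u0; try by rewrite Estar_lt2 ?scaler0.
apply: coef_onE; apply: thin_scalar (layer_vec_mem _) AuW _ u0 => //.
by rewrite Estar_layer_vec eqxx.
Qed.

Lemma Amx1_layer_vec i : (i.+1 <= D)%N -> (2 <= i)%N ==> (u i != 0) ->
  A 1 *m u i.+1 = c i *: u i.+2 + xi i.-1 *: u i.
Proof.
move=> hi u0; rewrite -(lower_layer_vec (ltnW hi) u0) -(raise_layer_vec hi).
apply: (Estar_ext ediam (x := x)) => j hj; rewrite mulmxDr !mulmxA !mul_Estar -!mulmxA.
have uE : Es i.+1 *m u i.+1 = u i.+1 by rewrite Estar_layer_vec eqxx.
have [->|j1] := eqVneq j i.+2; first by rewrite gtn_eqF // !mul0mx addr0.
have [->|j2] := eqVneq j i; first by rewrite !mul0mx add0r.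
by rewrite !mul0mx addr0 (Estar_Amx0 e_sym econn ebip uE) //; move: j1 j2; lia.
Qed.

(** A is real symmetric, so lowering is adjoint to raising: if u_{n+3} is lowered to 0, it is
    orthogonal to A u_{n+2}, whose part in layer n+3 is c_{n+1} u_{n+3}. Then u_{n+3} has norm 0. *)
Lemma lower_coef_neq0_at n : (n.+3 <= D)%N -> u n.+2 != 0 -> u n.+3 != 0 -> xi n.+1 != 0.
Proof.
move=> hn u2 u3; apply: contraNneq u3 => xi0.
have low : Es n.+2 *m (A 1 *m u n.+3) = 0.
  by rewrite lower_layer_vec // 1?xi0 ?scale0r //; lia.
have raise : Es n.+3 *m (A 1 *m u n.+2) = c n.+1 *: u n.+3.
  by rewrite raise_layer_vec //; lia.
have yE : Es n.+3 *m u n.+3 = u n.+3 by rewrite Estar_layer_vec eqxx.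
have zE : Es n.+2 *m u n.+2 = u n.+2 by rewrite Estar_layer_vec eqxx.
move: (u n.+3) (u n.+2) low raise yE zE => y z low raise yE zE.
(* The conjugate transpose, so that y' y is the squared norm of y. *)
pose y' := (map_mx Num.conj y)^T.
have trE i : (Es i)^T = Es i by rewrite /Estar tr_diag_mx.
have conjE i : map_mx Num.conj (Es i) = Es i.
  rewrite /Estar map_diag_mx; congr diag_mx; apply/rowP => r.
  by rewrite !mxE rmorph_nat.
have conjA : map_mx Num.conj (A 1) = A 1.
  by apply/matrixP => r s; rewrite !mxE rmorph_nat.
have y'E : y' *m Es n.+3 = y'.
  by rewrite -{1}(trE n.+3) -trmx_mul -{1}(conjE n.+3) -map_mxM yE.
have low' : y' *m A 1 *m Es n.+2 = 0.
  rewrite -(trE n.+2) -(Amx_tr C e_sym econn) -!trmx_mul -{1}(conjE n.+2) -{1}conjA.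
  by rewrite -!map_mxM low map_mx0 trmx0.
have : y' *m (A 1 *m z) = 0 by rewrite -zE !mulmxA low' !mul0mx.
rewrite -y'E -mulmxA raise -scalemxAr => /eqP.
rewrite scaler_eq0 (negPf (cnum_neq0 _)) /=; last by lia.
move=> /eqP/matrixP/(_ 0 0); rewrite !mxE.
under eq_bigr do rewrite !mxE mulrC -normCK.
move=> h; apply/eqP/colP => r; rewrite [RHS]mxE; apply/eqP.
rewrite -normr_eq0 -sqrf_eq0; apply/eqP.
by apply: (psumr_eq0P _ h) => // i _; rewrite exprn_ge0.
Qed.

(** * Polynomials in A applied to v *)

(* [S q] plays the role of q(A) v. *)
Variable S : {poly C} -> 'cV[C]_#|X|.
Hypotheses (S_lin : forall a p q, S (a *: p + q) = a *: S p + S q).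
Hypotheses (S_X : forall q, S ('X * q) = A 1 *m S q) (S_1 : S 1 = v).

Lemma S_0 : S 0 = 0.
Proof. by have := S_lin (-1) 0 0; rewrite scaler0 addr0 scaleN1r addNr. Qed.

Lemma S_Z a q : S (a *: q) = a *: S q.
Proof. by rewrite -[a *: q]addr0 S_lin S_0 addr0. Qed.

Lemma S_D p q : S (p + q) = S p + S q.
Proof. by have := S_lin 1 p q; rewrite !scale1r. Qed.

Local Notation p := (ppoly C e).

Lemma S_fpoly h : (h <= D)%N -> S (fpoly C e h) = A h *m v.
Proof.
suff H n : ((n <= D)%N -> S (fpoly C e n) = A n *m v) /\
           ((n < D)%N -> S (fpoly C e n.+1) = A n.+1 *m v) by exact: (proj1 (H h)).
elim: n => [|n [IH1 IH2]]; split=> // hn.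
- by rewrite S_1 Amx0 // mul1mx.
- rewrite /= (cnum1 eirr econn edrg ediam x) // invr1 scale1r.
  by rewrite -['X]mulr1 S_X S_1.
rewrite [fpoly _ _ _]/= -/(fpoly C e n.+1) S_Z addrC -scaleNr S_lin S_X.
rewrite IH1 1?IH2 //; try lia.
rewrite mulmxA mulA_Amx // mulmxDl -!scalemxAl scaleNr addKr scalerA.
by rewrite mulVf ?scale1r // cnum_neq0.
Qed.

Lemma S_ppoly_mem j : (j <= D)%N -> S (p j) \in W.
Proof.
suff H n : ((n <= D)%N -> S (p n) \in W) /\ ((n < D)%N -> S (p n.+1) \in W).
  exact: (proj1 (H j)).
elim: n => [|n [IH1 IH2]]; split=> // hn.
- by rewrite ppoly0 S_1 v_mem.
- by rewrite ppoly1 S_fpoly // Amx_mem // v_mem.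
by rewrite ppolySS S_D memvD ?IH1 // ?S_fpoly ?Amx_mem ?v_mem //; lia.
Qed.

(** The function of the distance that represents p_j(A), which is A_j + A_{j-2} + ... *)
Let step_fun j n : C := ((n <= j)%N && ~~ odd (j - n))%:R.

Lemma S_ppoly j : (j <= D)%N -> S (p j) = dist_mx e (step_fun j) *m v.
Proof.
suff H n : ((n <= D)%N -> S (p n) = dist_mx e (step_fun n) *m v) /\
    ((n < D)%N -> S (p n.+1) = dist_mx e (step_fun n.+1) *m v).
  exact: (proj1 (H j)).
elim: n => [|n [IH1 IH2]]; split=> // hn.
- rewrite ppoly0 S_1 -{1}[v]mul1mx -(Amx0 C econn); congr (_ *m _).
  apply/matrixP => r s; rewrite !mxE /step_fun; congr (_%:R); congr nat_of_bool.
  by move: (d _ _) => m; lia.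
- rewrite ppoly1 S_fpoly //; congr (_ *m _).
  apply/matrixP => r s; rewrite !mxE /step_fun; congr (_%:R); congr nat_of_bool.
  by move: (d _ _) => m; lia.
rewrite ppolySS S_D IH1 1?S_fpoly //; try lia.
rewrite -mulmxDl; congr (_ *m _); apply/matrixP => r s; rewrite !mxE /step_fun.
by rewrite -natrD; congr (_%:R); move: (d _ _) => m; lia.
Qed.

(** A vertex of layer i and one of layer 2 are at a distance n that differs from i by at most 2 and
    has the same parity. *)
Lemma Estar_dist_mx_congr i (a a' : nat -> C) :
  (forall n, (n <= i.+2)%N -> (i <= n.+2)%N -> ~~ odd (n + i) -> a n = a' n) ->
  Es i *m (dist_mx e a *m v) = Es i *m (dist_mx e a' *m v).
Proof.
move=> h; apply/colP => r; rewrite !EstarE.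
case hr: (d x (V r) == i); rewrite ?mul0r // !mul1r !mxE.
apply: eq_bigr => s _; rewrite -layer_v EstarE.
case hs: (d x (V s) == 2%N); rewrite ?mul0r ?mulr0 // !mxE h //.
- have := gdist_triangle econn (V r) x (V s).
  by rewrite (gdist_sym e_sym econn (V r) x) (eqP hr) (eqP hs) addn2.
- have := gdist_triangle econn x (V s) (V r).
  by rewrite (gdist_sym e_sym econn (V s) (V r)) (eqP hr) (eqP hs) add2n.
rewrite oddD (gdist_parity econn ebip (V r) (V s) x) (eqP hs).
by rewrite (gdist_sym e_sym econn (V r) x) (eqP hr) addbF addbb.
Qed.

Lemma dist_mx_const a : dist_mx e (fun=> a) *m v = 0.
Proof.
apply/colP => r; rewrite !mxE; under eq_bigr do rewrite mxE.
by rewrite -mulr_sumr v_sum mulr0.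
Qed.

Lemma Estar_S_ppoly i j : (j <= D)%N -> i != j ->
  Es i *m S (p j) = Es i *m u j.+2.
Proof.
move=> hj ij; rewrite Estar_layer_vec S_ppoly //.
have zero (a : C) : (forall n, (n <= i.+2)%N -> (i <= n.+2)%N -> ~~ odd (n + i) ->
    step_fun j n = a) -> Es i *m (dist_mx e (step_fun j) *m v) = 0.
  by move=> h; rewrite (Estar_dist_mx_congr (a' := fun=> a)) // dist_mx_const mulmx0.
case: (eqVneq i j.+2) => [->|ij2].
  rewrite /u; apply: (Estar_dist_mx_congr (a' := fun n => (n == j)%:R)) => n h1 h2 h3.
  by rewrite /step_fun; congr (_%:R); lia.
have [lt_ij|ge_ij] := ltnP i j.
  (* Below layer j every distance that occurs is at most j if it has the parity of j, so the
     function is constant there and v sums to 0. *)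
  apply: (zero (~~ odd (i + j))%:R) => n h1 h2 h3.
  rewrite /step_fun; congr (_%:R); lia.
(* Above layer j, apart from j + 2, the distances that occur have the wrong parity or exceed j. *)
apply: (zero 0) => n h1 h2 h3; rewrite /step_fun.
by have -> : (n <= j)%N && ~~ odd (j - n) = false by lia.
Qed.

(** Set to 0 below the endpoint, where W has no component; alpha_1 = 0 starts the recurrences. *)
Definition lift_coef j : C := if (j < 2)%N then 0 else coef_on (u j) (Es j *m S (p j)).
Local Notation alpha := lift_coef.

Lemma S_ppolyE j : (j <= D)%N -> (2 <= j)%N ==> (u j != 0) ->
  S (p j) = u j.+2 + alpha j *: u j.
Proof.
move=> hj uj; have aE : Es j *m S (p j) = alpha j *: u j.
  have SW := S_ppoly_mem hj; rewrite /alpha; case: ltnP => j2.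
    by rewrite scale0r Estar_lt2.
  rewrite j2 in uj; apply: coef_onE; apply: thin_scalar (layer_vec_mem _) SW _ uj => //.
  by rewrite Estar_layer_vec eqxx.
apply: (Estar_ext (x := x) ediam) => i hi; rewrite mulmxDr -scalemxAr.
have [->|ij] := eqVneq i j.
  by rewrite aE !Estar_layer_vec eqxx ltn_eqF // add0r.
by rewrite Estar_S_ppoly // [Es i *m u j]Estar_layer_vec (negPf ij) scaler0 addr0.
Qed.

(** * Non-vanishing of the layer vectors, and the recurrences for [alpha] and [xi] *)

Hypotheses (ereg : regular_of_valency e k) (v_neq0 : v != 0).

Lemma lift_coef1 : alpha 1 = 0. Proof. by []. Qed.

Lemma lift_coef2 : alpha 2 = 1 + eta.
Proof.
have S2 : S (p 2) = v + A 2 *m v.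
  by rewrite ppolySS ppoly0 S_D S_1 S_fpoly //; lia.
have := S_ppolyE (j := 2) ltac:(lia); rewrite layer_vec2 v_neq0 => /(_ isT).
move/(congr1 (mulmx (Es 2))); rewrite S2 !mulmxDr v_eta -scalemxAr.
rewrite Estar_layer_vec /= add0r layer_v -{1}[v]scale1r -scalerDl => /eqP.
rewrite -subr_eq0 -scalerBl scaler_eq0 (negPf v_neq0) orbF subr_eq0 => /eqP.
by move=> ->.
Qed.

(** In terms of degrees: a nonzero polynomial killing v has degree at least D - 1. *)
Hypothesis S_annihilator : forall q, q != 0 -> S q = 0 -> (D <= size q)%N.

(** As u_{n+2} = q(A) v with q of degree n <= D - 2, it cannot vanish. The two claims are proved
    together, since the tridiagonal relation giving the next q needs the earlier vectors to be
    nonzero. *)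
Lemma layer_vec_poly n : (n.+2 <= D)%N ->
  u n.+2 != 0 /\ exists2 q : {poly C}, size q = n.+1 & u n.+2 = S q.
Proof.
suff step m : (m.+2 <= D)%N ->
    (exists2 q : {poly C}, size q = m.+1 & u m.+2 = S q) ->
    u m.+2 != 0 /\ exists2 q : {poly C}, size q = m.+1 & u m.+2 = S q.
  suff H m : ((m.+2 <= D)%N ->
      u m.+2 != 0 /\ exists2 q : {poly C}, size q = m.+1 & u m.+2 = S q) /\
    ((m.+3 <= D)%N ->
      u m.+3 != 0 /\ exists2 q : {poly C}, size q = m.+2 & u m.+3 = S q).
    exact: (proj1 (H n)).
  elim: m => [|m [IH1 IH2]]; split=> // hm; apply: step => //.
  - by exists 1; rewrite ?size_poly1 // S_1 layer_vec2.
  - exists 'X; first by rewrite size_polyX.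
    rewrite -['X]mulr1 S_X S_1 -layer_vec2 (@Amx1_layer_vec 1) //; last by lia.
    by rewrite (cnum1 eirr econn edrg ediam x) ?scale1r ?scaler0 ?addr0 //; lia.
  have [u2 [q2 s2 E2]] := IH1 ltac:(lia); have [_ [q3 s3 E3]] := IH2 ltac:(lia).
  have cn : c m.+2 != 0 by apply: cnum_neq0; lia.
  (* Solves A u_{m+3} = c_{m+2} u_{m+4} + xi_{m+1} u_{m+2} for u_{m+4}. *)
  exists ((c m.+2)^-1 *: ('X * q3 + (- xi m.+1) *: q2)).
    rewrite size_scale ?invr_eq0 // size_polyDl mulrC size_mulX -?size_poly_gt0 s3 //.
    by apply: leq_ltn_trans (size_scale_leq _ _) _; rewrite s2.
  rewrite S_Z addrC S_lin S_X -E2 -E3 (@Amx1_layer_vec m.+2) //; last by lia.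
  by rewrite scaleNr addrC addrK scalerA mulVf ?scale1r.
move=> hm [q sq uq]; split; last by exists q.
apply/eqP => u0; have q0 : q != 0 by rewrite -size_poly_gt0 sq.
by have := S_annihilator q0; rewrite -uq u0 sq => /(_ erefl); lia.
Qed.

Lemma layer_vec_neq0 i : (2 <= i <= D)%N -> u i != 0.
Proof. by case: i => [|[|i]] // /layer_vec_poly[]. Qed.

Lemma layer_vec_neq0_imp i : (i <= D)%N -> (2 <= i)%N ==> (u i != 0).
Proof. by move=> hi; apply/implyP => i2; apply: layer_vec_neq0; rewrite i2. Qed.

Lemma lower_coef_neq0 n : (n.+3 <= D)%N -> xi n.+1 != 0.
Proof. by move=> hn; apply: lower_coef_neq0_at => //; apply: layer_vec_neq0; lia. Qed.

Lemma S_ppoly_rec n : (n.+2 <= D)%N ->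
  A 1 *m S (p n.+1) = c n.+2 *: S (p n.+2) + b n.+2 *: S (p n).
Proof.
move=> hn; rewrite -S_X (ppoly_rec (D := D) (k := k)) //; first by rewrite S_D !S_Z.
- exact: cnum_neq0.
- exact: cnum0 edrg x.
by move=> i hi; apply: cnum_add_bnum hi.
Qed.

(** The coefficients of u_{n+2} in the recurrence for A p_{n+1}(A) v. *)
Lemma lower_lift_coef n : (n.+4 <= D)%N ->
  xi n.+1 + alpha n.+1 * c n = c n.+2 * alpha n.+2 + b n.+2.
Proof.
move=> hn; have := congr1 (mulmx (Es n.+2)) (@S_ppoly_rec n ltac:(lia)).
rewrite !S_ppolyE ?layer_vec_neq0_imp //; try lia.
rewrite !mulmxDr -!scalemxAr !mulmxDr -!scalemxAr !Estar_layer_vec.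
rewrite lower_layer_vec ?layer_vec_neq0_imp ?raise_layer_vec //; try lia.
have -> : (n.+2 == n.+4) = false by lia.
have -> : (n.+2 == n) = false by lia.
rewrite eqxx !scaler0 add0r addr0.
rewrite !scalerA -!scalerDl => /eqP.
rewrite -subr_eq0 -scalerBl scaler_eq0 (negPf (layer_vec_neq0 _)) ?orbF; last by lia.
by rewrite subr_eq0 => /eqP.
Qed.

(** The coefficients of u_{n+2} in the recurrence for A p_{n+3}(A) v, two layers lower than in the
    previous comparison. *)
Lemma lift_coef_rec n : (n.+4 < D)%N -> alpha n.+3 * xi n.+1 = b n.+4 * alpha n.+2.
Proof.
move=> hn; have := congr1 (mulmx (Es n.+2)) (@S_ppoly_rec n.+2 ltac:(lia)).
rewrite !S_ppolyE ?layer_vec_neq0_imp //; try lia.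
rewrite !mulmxDr -!scalemxAr !mulmxDr -!scalemxAr.
rewrite lower_layer_vec ?layer_vec_neq0_imp //; try lia.
have uE : Es n.+4.+1 *m u n.+4.+1 = u n.+4.+1 by rewrite Estar_layer_vec eqxx.
rewrite (Estar_Amx0 e_sym econn ebip uE); last by apply/or4P; apply: Or42; lia.
rewrite !Estar_layer_vec eqxx.
have -> : (n.+2 == n.+4) = false by lia.
have -> : (n.+2 == n.+4.+2) = false by lia.
rewrite !(scaler0, add0r) !scalerA => /eqP.
rewrite -subr_eq0 -scalerBl scaler_eq0 (negPf (layer_vec_neq0 _)) ?orbF; last by lia.
by rewrite subr_eq0 => /eqP.
Qed.

(** Both sides satisfy the same two-step recursion: u_{n+4} = p_{n+2}(A) v - alpha_{n+2} u_{n+2} and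
    g_{n+2} = p_{n+2} - alpha_{n+2} g_n. *)
Lemma layer_vec_gpoly psi i : 1 + eta != 0 -> psi = b 2 * (1 - b 3 / (1 + eta)) ->
  (i.+2 <= D)%N -> u i.+2 = S (gpoly e psi i).
Proof.
move=> eta1 psiE.
have cn : forall i, (0 < i <= D)%N -> c i != 0 by exact: cnum_neq0.
have c0 := cnum0 edrg x.
have cb : forall i, (i <= D)%N -> (cnum e i + bnum e i = k)%N.
  by move=> j hj; apply: cnum_add_bnum hj.
have bn : forall i, (i < D)%N -> b i != 0 by move=> j hj; apply: bnum_neq0 hj.
have c1 : c 1 = 1 by rewrite (cnum1 eirr econn edrg ediam x) //; lia.
suff H n : ((n.+2 <= D)%N -> u n.+2 = S (gpoly e psi n)) /\
    ((n.+3 <= D)%N -> u n.+3 = S (gpoly e psi n.+1)) by exact: (proj1 (H i)).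
elim: n => [|n [IH1 IH2]]; split=> // hn.
- by rewrite (gpoly0 cn bn psi ltac:(lia)) ppoly0 S_1 layer_vec2.
- rewrite (gpoly1 cn bn c1 psi ltac:(lia)) S_ppolyE ?lift_coef1 ?scale0r ?addr0 //.
  by lia.
rewrite (gpolySS cn bn c1 c0 cb D_ge4 eta1 psiE lift_coef1 lift_coef2
  lower_coef_neq0 lower_lift_coef lift_coef_rec hn).
rewrite addrC -scaleNr S_lin -IH1; last by lia.
rewrite S_ppolyE ?layer_vec_neq0_imp //; try lia.
by rewrite addrC scaleNr addrK.
Qed.

(** Now alpha_2 = 1 + eta = 0, and as xi does not vanish the recurrence carries this zero to every
    later alpha in range. *)
Lemma layer_vec_ppoly i : eta = -1 -> (i.+2 <= D)%N -> u i.+2 = S (p i).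
Proof.
move=> etaE hi; have a2 : alpha 2 = 0 by rewrite lift_coef2 etaE subrr.
rewrite S_ppolyE ?layer_vec_neq0_imp //; try lia.
suff -> : alpha i = 0 by rewrite scale0r addr0.
case: i hi => [|[|i]] // hi.
elim: i hi => // i IH hi.
apply: (mulIf (@lower_coef_neq0 i ltac:(lia))).
by rewrite lift_coef_rec // IH ?mulr0 ?mul0r //; lia.
Qed.

End ThinModule.

(** * Primitive idempotents *)

Section Idempotents.
Variables (C : numClosedFieldType) (X : finType) (e : rel X) (D k : nat).
Variables (x : X) (theta : nat -> C) (E : nat -> 'M[C]_#|X|).
Hypotheses (e_sym : symmetric e) (eirr : irreflexive e).
Hypotheses (econn : connected_graph e) (ebip : bipartite e).
Hypotheses (edrg : distance_regular e) (ediam : diameter e = D).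
Hypotheses (ereg : regular_of_valency e k) (D_ge4 : (4 <= D)%N).
Hypotheses (thetaP : ordered_eigenvalues e D theta).
Hypotheses (EP : primitive_idempotents e D theta E).
Variables (v : 'cV[C]_#|X|) (eta : C).
Hypotheses (v2 : Estar C e x 2 *m v = v) (v_sum : \sum_s v s 0 = 0).
Local Notation A := (Amx C e).
Local Notation b i := ((bnum e i)%:R : C).

Lemma idempotent_dist_mx j : (j <= D)%N ->
  exists2 a, E j = dist_mx e a & A 1 *m dist_mx e a = theta j *: dist_mx e a.
Proof.
case: EP => hBM _ _ hA hj; have [[a Ea] _] := hBM j hj.
rewrite (dist_mx_sum ediam) in Ea.
by exists a => //; rewrite -Ea hA.
Qed.

Lemma idempotent0_v : E 0 *m v = 0.
Proof.
have [a -> ha] := idempotent_dist_mx (leq0n D).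
apply: (dist_mx_sign e_sym eirr econn ebip v2 v_sum edrg ediam ereg (s := 1)).
  by rewrite expr1n.
by rewrite mul1r ha (theta0E x e_sym eirr econn ereg thetaP).
Qed.

Lemma idempotentD_v : E D *m v = 0.
Proof.
have [a -> ha] := idempotent_dist_mx (leqnn D).
apply: (dist_mx_sign e_sym eirr econn ebip v2 v_sum edrg ediam ereg (s := -1)).
  by rewrite sqrrN expr1n.
by rewrite mulN1r ha (thetaDE x e_sym eirr econn ebip ereg thetaP).
Qed.


(** The vector q(A) v in spectral form; the indices 0 and D are left out because E_0 and E_D kill
    v. *)
Definition spectral_vec (q : {poly C}) : 'cV[C]_#|X| :=
  \sum_(1 <= j < D) q.[theta j] *: (E j *m v).
Local Notation S := spectral_vec.

Lemma spectral_vec_lin a p q : S (a *: p + q) = a *: S p + S q.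
Proof.
rewrite /S scaler_sumr -big_split /=; apply: eq_bigr => j _.
by rewrite !hornerE scalerDl scalerA.
Qed.

Lemma spectral_vecX q : S ('X * q) = A 1 *m S q.
Proof.
rewrite /S mulmx_sumr; apply: eq_big_nat => j hj.
case: EP => _ _ _ hA; rewrite -scalemxAr mulmxA hA; last by lia.
by rewrite -scalemxAl scalerA !hornerE mulrC.
Qed.

Lemma spectral_vec1 : S 1 = v.
Proof.
case: EP => _ _ hsum _; rewrite -[RHS]mul1mx -hsum mulmx_suml.
rewrite big_ltn // idempotent0_v add0r big_nat_recr /=; last by lia.
rewrite idempotentD_v addr0; apply: eq_bigr => j _.
by rewrite hornerC scale1r.
Qed.

Hypotheses (v_neq0 : v != 0)
  (v_eta : Estar C e x 2 *m (Amx C e 2 *m v) = eta *: v).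
Hypotheses (eta_gt : tilde e (theta 1%N) < eta) (eta_lt : eta < tilde e (theta D./2)).

(* Positive at both ends theta_1^2, theta_d^2 of the range of theta_j^2, hence
   positive throughout; the junk value 0^-1 = 0 in [tilde] does no harm. *)
Lemma eta_affine_gt0 j : (0 < j < D)%N ->
  0 < b 2 * b 3 + (1 + eta) * (theta j ^+ 2 - b 2).
Proof.
move=> hj; have B0 : 0 < b 2 * b 3.
  by rewrite -natrM ltr0n muln_gt0 !(bnum_gt0 e_sym eirr econn edrg ediam x) //; lia.
set y1 := theta 1 ^+ 2 - b 2; set yd := theta D./2 ^+ 2 - b 2.
set y := theta j ^+ 2 - b 2.
have y_le : y <= y1.
  rewrite lerD2r; apply: (theta_sq_le eirr econn ebip thetaP) => //; lia.
have y_ge : yd <= y.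
  by rewrite lerD2r (theta_half_sq_le eirr econn ebip thetaP) //; lia.
have yd_lt : yd < y1.
  rewrite ltrD2r ltr_pXn2r ?nnegrE ?(theta_half_ge0 eirr econn ebip thetaP) //.
    by apply: (theta_lt thetaP); lia.
  lia.
set B := b 2 * b 3 in B0 *.
have h1 : - (B * y1^-1) < 1 + eta.
  move: eta_gt; rewrite /tilde -/y1 -/B -subr_gt0 => h; rewrite -subr_gt0.
  by move: h; congr (_ < _); ring.
have hd : 1 + eta < - (B * yd^-1).
  move: eta_lt; rewrite /tilde -/yd -/B -subr_gt0 => h; rewrite -subr_gt0.
  by move: h; congr (_ < _); ring.
have realB : B \is Num.real by rewrite gtr0_real.
have y1r : y1 \is Num.real.
  rewrite rpredB ?rpred_nat // rpredX // ger0_real //.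
  by rewrite (theta_half_ge0 eirr econn ebip thetaP) //; lia.
have ydr : yd \is Num.real.
  rewrite rpredB ?rpred_nat // rpredX // ger0_real //.
  by rewrite (theta_half_ge0 eirr econn ebip thetaP) //; lia.
(* The two bounds on 1 + eta are compatible only if inversion keeps the order yd < y1, which
   excludes that both are positive or both negative. *)
have inv_lt : yd^-1 < y1^-1.
  by rewrite -(ltr_pM2l B0) -ltrN2; apply: lt_trans h1 hd.
have y1_ge0 : 0 <= y1.
  rewrite real_leNgt ?real0 //; apply/negP => y1n.
  have ydn := lt_trans yd_lt y1n.
  move: inv_lt; rewrite ltf_nV2 ?negrE // => /(lt_trans yd_lt).
  by rewrite ltxx.
have yd_le0 : yd <= 0.
  rewrite real_leNgt ?real0 //; apply/negP => ydp.
  have y1p := lt_trans ydp yd_lt.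
  move: inv_lt; rewrite ltf_pV2 ?posrE // => /(lt_trans yd_lt).
  by rewrite ltxx.
have p1 : 0 < B + (1 + eta) * y1.
  move: y1_ge0; rewrite le_eqVlt => /orP[/eqP <-|y1p]; first by rewrite mulr0 addr0.
  move: h1; rewrite -(ltr_pM2r y1p) mulNr -mulrA mulVf ?mulr1 ?gt_eqF //.
  by rewrite -subr_gt0 opprK addrC.
have pd : 0 < B + (1 + eta) * yd.
  move: yd_le0; rewrite le_eqVlt => /orP[/eqP ->|ydn]; first by rewrite mulr0 addr0.
  move: hd; rewrite -(ltr_nM2r ydn) mulNr -mulrA mulVf ?mulr1 ?lt_eqF //.
  by rewrite -subr_gt0 opprK addrC.
(* An affine function at y is a convex combination of its values at [yd] and [y1]. *)
rewrite -(pmulr_rgt0 _ (_ : 0 < y1 - yd)) ?subr_gt0 //.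
have -> : (y1 - yd) * (B + (1 + eta) * y) =
  (y - yd) * (B + (1 + eta) * y1) + (y1 - y) * (B + (1 + eta) * yd) by ring.
move: y_ge; rewrite le_eqVlt => /orP[/eqP <-|y_gt].
  by rewrite subrr mul0r add0r mulr_gt0 // subr_gt0.
by apply: ltr_wpDr; [rewrite mulr_ge0 ?subr_ge0 // ltW | rewrite mulr_gt0 ?subr_gt0].
Qed.

(** If E_j v were 0, so would be its layer-2 coefficient; but up to a nonzero factor that is a_0
    (k^2 - theta_j^2) times the affine expression in eta, and none of the three vanishes. *)
Lemma idempotent_v_neq0 j : (0 < j < D)%N -> E j *m v != 0.
Proof.
move=> hj; have hjD : (j <= D)%N by lia.
have [a Ea ha] := idempotent_dist_mx hjD.
have a0 : a 0 != 0.
  apply: (dist_mx_first_neq0 x e_sym eirr econn ebip edrg ediam ha).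
  by rewrite -Ea; case: EP => /(_ j hjD)[].
apply: contraNneq a0 => Ev.
have := dist_mx_layer2 e_sym econn ebip v2 v_sum a v_eta.
rewrite -Ea Ev mulmx0 => /esym/eqP; rewrite scaler_eq0 (negPf v_neq0) orbF => /eqP h0.
have := cosine_identity x e_sym eirr econn ebip edrg ediam ereg eta D_ge4 ha.
rewrite h0 mul0r => /esym/eqP; rewrite !mulf_eq0 -orbA => /or3P[->//||] /eqP h.
  by have := theta_sq_lt x e_sym eirr econn ebip ereg thetaP hj; rewrite -subr_gt0 h ltxx.
by have := eta_affine_gt0 hj; rewrite h ltxx.
Qed.

(** Applying E_j gives q(theta_j) E_j v = 0 with E_j v <> 0, so q has the D - 1 distinct roots
    theta_1, ..., theta_{D-1}. *)
Lemma spectral_vec_annihilator q : q != 0 -> S q = 0 -> (D <= size q)%N.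
Proof.
move=> q0 Sq; pose s := [seq theta j | j <- index_iota 1 D].
have us : uniq s.
  rewrite map_inj_in_uniq ?iota_uniq // => i j; rewrite !mem_index_iota => hi hj hij.
  case: (ltngtP i j) => // h.
    by have := theta_lt thetaP h ltac:(lia); rewrite hij ltxx.
  by have := theta_lt thetaP h ltac:(lia); rewrite hij ltxx.
have rs : all (root q) s.
  apply/allP => _ /mapP[j hj ->]; move: hj; rewrite mem_index_iota => hj.
  have /eqP := congr1 (mulmx (E j)) Sq.
  rewrite mulmx0 /S mulmx_sumr (bigD1_seq j) ?mem_index_iota ?iota_uniq //=.
  case: EP => _ EE _ _.
  rewrite big_seq_cond big1 ?addr0 => [|i].
    rewrite -scalemxAr mulmxA EE ?eqxx; try lia.
    by rewrite scaler_eq0 (negPf (idempotent_v_neq0 hj)) orbF.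
  rewrite mem_index_iota => /andP[hi ij].
  by rewrite -scalemxAr mulmxA EE 1?eq_sym ?(negPf ij) ?mul0mx ?scaler0 //; lia.
have := max_poly_roots q0 rs us; rewrite size_map size_iota.
by rewrite -ltnS -(prednK (ltnW (ltnW (ltnW D_ge4)))) subn1.
Qed.

End Idempotents.

(** * The spectral sum put in the place of the abstract [S], and the two cases for [eta] *)

Theorem theorem16p7 (C : numClosedFieldType) (X : finType) (e : rel X)
  (D k : nat) (theta : nat -> C) (E : nat -> 'M[C]_#|X|)
  (x : X) (W : {vspace 'cV[C]_#|X|}) (eta : C) (v : 'cV[C]_#|X|)
  (He : simple_graph e) (Hconn : connected_graph e) (Hbip : bipartite e)
  (Hdrg : distance_regular e) (HD : diameter e = D) (HD4 : (4 <= D)%N)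
  (Hk : regular_of_valency e k) (Hk3 : (3 <= k)%N)
  (Htheta : ordered_eigenvalues e D theta)
  (HE : primitive_idempotents e D theta E)
  (HW : irreducible_Tmodule e x D W) (Hthin : thin e x D W)
  (Hend : has_endpoint e x W 2) (Heta : local_eigenvalue e x W eta)
  (Heta1 : tilde e (theta 1%N) < eta) (Hetad : eta < tilde e (theta D./2))
  (Hv : v \in EstarV e x 2 W) (Hv0 : v != 0) :
  (eta != -1 ->
     let psi : C := (bnum e 2)%:R * (1 - (bnum e 3)%:R / (1 + eta)) in
     forall i : nat, (i <= D - 2)%N ->
       Estar C e x (i + 2)%N *m Amx C e i *m v =
       \sum_(1 <= j < D) (gpoly e psi i).[theta j] *: (E j *m v)) /\
  (eta = -1 ->
     forall i : nat, (i <= D - 2)%N ->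
       Estar C e x (i + 2)%N *m Amx C e i *m v =
       \sum_(1 <= j < D) (ppoly C e i).[theta j] *: (E j *m v)).
Proof.
have [e_sym eirr] := He; have [Wmod _ _] := HW.
have v2 := layer_v Hv.
have v_s := v_sum e_sym eirr Hconn Hbip Hdrg HD Wmod Hend Hv HD4.
have v_e := v_eta HD Wmod Hthin Hv HD4 Heta.
pose S := spectral_vec D theta E v.
have S_lin : forall a p q, S (a *: p + q) = a *: S p + S q.
  exact: spectral_vec_lin.
have S_X : forall q, S ('X * q) = Amx C e 1 *m S q by apply: spectral_vecX HE _.
have S_1 : S 1 = v.
  exact: (spectral_vec1 e_sym eirr Hconn Hbip Hdrg HD Hk HD4 Htheta HE v2 v_s).
have S_ann : forall q, q != 0 -> S q = 0 -> (D <= size q)%N.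
  exact: (spectral_vec_annihilator e_sym eirr Hconn Hbip Hdrg HD Hk HD4 Htheta
    HE v2 v_s Hv0 v_e Heta1 Hetad).
have EsE i : Estar C e x (i + 2)%N *m Amx C e i *m v = layer_vec e x v i.+2.
  by rewrite -mulmxA addn2.
split=> [eta_neq psi i hi | eta_eq i hi]; rewrite EsE.
  apply: (layer_vec_gpoly e_sym eirr Hconn Hbip Hdrg HD Wmod Hthin Hend Hv HD4
    Heta S_lin S_X S_1 Hk Hv0 S_ann) => //; last by lia.
  by rewrite addrC -[1]opprK subr_eq0.
apply: (layer_vec_ppoly e_sym eirr Hconn Hbip Hdrg HD Wmod Hthin Hend Hv HD4
  Heta S_lin S_X S_1 Hk Hv0 S_ann) => //; lia.
Qed.
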